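(* Let $S\subset\mathbb R^n$ be a compact computable convex set, let $\epsilon>0$ be rational, and let $x_0,y_0\in S$ be computable points with $|x_0-y_0|>\epsilon$. In the game $\Gamma(S,\epsilon)$, Pursuer has a winning strategy $u$ such that for every continuous $v\in C_E$ the trajectory $x_{u,v}$ is a function computable relative to $v$.
   Context: A non-empty closed convex set $S\subseteq\mathbb R^n$ is called computable if the set of all rational points in $S$ (points of $S\cap\mathbb Q^n$) is a decidable set and is dense in $S$. The game $\Gamma(S,\epsilon)$: Pursuer's position $x(t)$ and Evader's position $y(t)$ evolve by $\dot x=u$, $x(0)=x_0$, and $\dot y=v$, $y(0)=y_0$, where the controls are taken from the spaces $C_P$ and $C_E$ of Borel (not necessarily continuous) functions with $|u(t)|\le1$ and $|v(t)|\le 1$ for $t\ge0$; $|\cdot|$ is the Euclidean norm. Both players must stay inside $S$: $x(t),y(t)\in S$ for all $t\ge0$. At all times the players know the current velocities and positions. A strategy $u$ of Pursuer depends on $(x,y,v)$, where $x$ is Pursuer's position, $y$ is Evader's position and $v$ is Evader's velocity at $y$. If Pursuer follows $u$ and Evader follows $v(t)\in C_E$, then Pursuer's velocity at time $t$ is $u(x(t),y(t),v(t))$ and Pursuer's trajectory consistent with $u$ is $$x_{u,v}(t)=x_0+\int_0^t u(x(s),y(s),v(s))\,ds,$$ where $x(s)=x_{u,v}(s)$ and $y(s)=y_0+\int_0^s v(r)\,dr$. The strategy $u$ is winning (Pursuer completes pursuit) if for all $v\in C_E$ (keeping Evader in $S$) there is a time $t_v$ with $|x(t_v)-y(t_v)|\le\epsilon$.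 A function $\phi:\mathbb N\to\mathbb Q^m$ represents $z\in\mathbb R^m$ if $|z-\phi(k)|\le 2^{-k}$ for all $k$; $z$ is computable if it has a computable representation. A function $f$ on a subset of $\mathbb R$ with values in $\mathbb R^n$ is computable if some oracle Turing machine, given any representation of $z$ as oracle, outputs for each $j$ a rational point within $2^{-j}$ of $f(z)$; it is computable relative to a continuous function $v$ if the same holds when the machine additionally has oracle access to (a standard representation of) $v$. *)

(* Defs.v *)
From HB Require Import structures.
From mathcomp Require Import all_boot all_order all_algebra.
From mathcomp Require Import all_classical all_reals all_analysis.
Import Order.TTheory GRing.Theory Num.Theory.
Import numFieldNormedType.Exports.

Set Implicit Arguments.
Unset Strict Implicit.
Unset Printing Implicit Defensive.

Local Open Scope classical_set_scope.
Local Open Scope ring_scope.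

(** * Multi-tape oracle Turing machines

    A machine has a finite state set, a finite tape alphabet, finitely many
    two-way infinite tapes and access to [m] oracles [nat -> nat].  Numbers are
    read and written in unary.  A [Query i s] instruction reads a number [q] on
    the query tape, replaces the content of the answer tape by the value of the
    [i]-th oracle at [q], and goes to state [s].  With [m = 0] these are ordinary
    Turing machines. *)

Inductive tm_move := MoveL | Stay | MoveR.

Inductive tm_instr (m : nat) (state sym tape : finType) :=
| Halt
| Query of 'I_m & state
| Act of ({ffun tape -> sym} -> state * (tape -> sym * tm_move)).

Record oracle_tm (m : nat) := OracleTM {
  tm_state : finType;
  tm_sym : finType;
  tm_tape : finType;
  tm_blank : tm_sym;
  tm_one : tm_sym;
  tm_one_neq_blank : tm_one != tm_blank;
  tm_in : tm_tape;
  tm_out : tm_tape;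
  tm_ask : tm_tape;
  tm_ans : tm_tape;
  tm_start : tm_state;
  tm_prog : tm_state -> tm_instr m tm_state tm_sym tm_tape
}.

Section Run.
Variables (m : nat) (M : oracle_tm m) (O : m.-tuple (nat -> nat)).

(* Symbols strictly left of the head, nearest first, and symbols from the head
   rightwards; all remaining cells are blank. *)
Definition tape_content := (seq (tm_sym M) * seq (tm_sym M))%type.

Definition tape_read (T : tape_content) : tm_sym M := head (tm_blank M) T.2.

Definition tape_act (T : tape_content) (a : tm_sym M * tm_move) :
    tape_content :=
  match a.2 with
  | MoveL => (behead T.1, head (tm_blank M) T.1 :: a.1 :: behead T.2)
  | Stay => (T.1, a.1 :: behead T.2)
  | MoveR => (a.1 :: T.1, behead T.2)
  end.

Definition tape_of_nat (k : nat) : tape_content := ([::], nseq k (tm_one M)).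

(* The length of the maximal run of ones that starts under the head. *)
Definition nat_of_tape (T : tape_content) : nat :=
  find (predC1 (tm_one M)) T.2.

Definition config := (tm_state M * {ffun tm_tape M -> tape_content})%type.

Definition tm_init (a : nat) : config :=
  (tm_start M, [ffun i => tape_of_nat (if i == tm_in M then a else 0%N)]).

Definition tm_step (c : config) : config :=
  match tm_prog c.1 with
  | Halt => c
  | Query i s =>
      (s, [ffun j => if j == tm_ans M
                     then tape_of_nat (tnth O i (nat_of_tape (c.2 (tm_ask M))))
                     else c.2 j])
  | Act delta =>
      let r := delta [ffun j => tape_read (c.2 j)] in
      (r.1, [ffun j => tape_act (c.2 j) (r.2 j)])
  end.

Definition halted (c : config) : Prop := tm_prog c.1 = Halt _ _ _ _.

Definition tm_outputs (a b : nat) : Prop :=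
  exists t : nat, let c := iter t tm_step (tm_init a) in
    halted c /\ nat_of_tape (c.2 (tm_out M)) = b.

End Run.

Definition decidable_nat (A : set nat) : Prop :=
  exists M : oracle_tm 0, forall c : nat,
    (A c -> tm_outputs M [tuple] c 1) /\ (~ A c -> tm_outputs M [tuple] c 0).

(** * Numberings of Q and Q^n

    [nuQ] is the numbering <i, j, k> |-> (i - j) / (k + 1).  A number codes a
    point of Q^n through the list of codes of its coordinates.  Every point has
    a code (in fact infinitely many): see [nuQn_surj]. *)

Definition nuQ (c : nat) : rat :=
  let s := CodeSeq.decode c in
  ((nth 0%N s 0)%:R - (nth 0%N s 1)%:R) / (nth 0%N s 2).+1%:R.

Definition nuQn (n : nat) (c : nat) : 'rV[rat]_n :=
  \row_(i < n) nuQ (nth 0%N (CodeSeq.decode c) i).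

Lemma nuQ_surj (q : rat) : exists c : nat, nuQ c = q.
Proof.
have dE : (`|denq q|%N.-1.+1 = `|denq q|)%N by rewrite prednK ?absz_gt0 ?denq_neq0.
have dR : (`|denq q|%N)%:R = (denq q)%:~R :> rat.
  by rewrite -[in RHS](gtz0_abs (denq_gt0 q)).
have [q0|q0] := leP 0 (numq q).
- exists (CodeSeq.code [:: `|numq q|; 0; `|denq q|.-1]%N).
  rewrite /nuQ CodeSeq.codeK /= dE dR subr0 -[RHS]divq_num_den.
  by rewrite -[in RHS](gez0_abs q0).
- exists (CodeSeq.code [:: 0; `|numq q|; `|denq q|.-1]%N).
  rewrite /nuQ CodeSeq.codeK /= dE dR sub0r -[RHS]divq_num_den.
  by rewrite -[in RHS](opprK (numq q)) -(ltz0_abs q0) mulrNz.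
Qed.

Lemma nuQn_surj (n : nat) (q : 'rV[rat]_n) : exists c : nat, nuQn n c = q.
Proof.
have /choice[f fE] := nuQ_surj.
exists (CodeSeq.code [seq f (q 0 i) | i <- enum 'I_n]).
apply/rowP => i; rewrite mxE CodeSeq.codeK (nth_map i) ?size_enum_ord //.
by rewrite nth_ord_enum fE.
Qed.

(** * Computable points and computable convex sets *)

Definition enorm (R : realType) (n : nat) (z : 'rV[R]_n) : R :=
  Num.sqrt (\sum_(i < n) z 0 i ^+ 2).

Definition rpoint (R : realType) (n : nat) (q : 'rV[rat]_n) : 'rV[R]_n :=
  map_mx ratr q.

Definition represents (R : realType) (n : nat) (phi : nat -> 'rV[rat]_n)
    (z : 'rV[R]_n) : Prop :=
  forall k : nat, enorm (z - rpoint R (phi k)) <= 2 ^- k.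

Definition computable_seq (n : nat) (phi : nat -> 'rV[rat]_n) : Prop :=
  exists M : oracle_tm 0, forall k : nat,
    exists2 c : nat, tm_outputs M [tuple] k c & nuQn n c = phi k.

Definition computable_point (R : realType) (n : nat) (z : 'rV[R]_n) : Prop :=
  exists2 phi : nat -> 'rV[rat]_n, computable_seq phi & represents phi z.

Definition computable_convex_set (R : realType) (n : nat)
    (S : set 'rV[R]_n) : Prop :=
  [/\ S !=set0,
      closed S,
      @convex_set R 'rV[R]_n S,
      decidable_nat [set c | S (rpoint R (nuQn n c))] &
      S `<=` closure (S `&` range (@rpoint R n))].

(** * Functions of time computable relative to a continuous function *)

(* Oracles [a], [b] give a standard representation of a continuous function [v]
   on [0, +oo[: approximations of [v] at the nonnegative rationals, and a modulus
   of uniform continuity on each interval [0, N]. *)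
Definition represents_fun (R : realType) (n : nat) (a b : nat -> nat)
    (v : R -> 'rV[R]_n) : Prop :=
  (forall q k : nat, 0 <= nuQ q ->
     enorm (v (ratr (nuQ q)) - rpoint R (nuQn n (a (CodeSeq.code [:: q; k]))))
       <= 2 ^- k)
  /\
  (forall (N k : nat) (s t : R), 0 <= s <= N%:R -> 0 <= t <= N%:R ->
     `|s - t| <= 2 ^- b (CodeSeq.code [:: N; k]) ->
     enorm (v s - v t) <= 2 ^- k).

(* [f] is only considered on [0, +oo[; the time [t] is viewed as a point of
   R^1.  The oracle [p] is an arbitrary coding of a representation of [t]. *)
Definition computable_relative (R : realType) (n : nat) (v f : R -> 'rV[R]_n) :
    Prop :=
  exists M : oracle_tm 3,
  forall (t : R) (p a b : nat -> nat),
    0 <= t -> represents (nuQn 1 \o p) (const_mx t) -> represents_fun a b v ->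
  forall j : nat,
    exists2 c : nat, tm_outputs M [tuple p; a; b] j c &
      enorm (rpoint R (nuQn n c) - f t) <= 2 ^- j.

(** * The pursuit game *)

(* Borel functions of time with values in the closed unit ball; only times
   t >= 0 matter. *)
Definition control (R : realType) (n : nat) (w : R -> 'rV[R]_n) : Prop :=
  (forall i : 'I_n, measurable_fun (`[0, +oo[ : set R) (fun t : R => w t 0 i)) /\
  (forall t : R, 0 <= t -> enorm (w t) <= 1).

Definition position (R : realType) (n : nat) (z0 : 'rV[R]_n)
    (w : R -> 'rV[R]_n) (t : R) : 'rV[R]_n :=
  z0 + \row_(i < n) \int[lebesgue_measure]_(s in `[0, t]) w s 0 i.

Definition stays_in (R : realType) (n : nat) (S : set 'rV[R]_n)
    (z : R -> 'rV[R]_n) : Prop :=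
  forall t : R, 0 <= t -> S (z t).

(* Evader's legal controls. *)
Definition evasion (R : realType) (n : nat) (S : set 'rV[R]_n) (y0 : 'rV[R]_n)
    (v : R -> 'rV[R]_n) : Prop :=
  control v /\ stays_in S (position y0 v).

(* Pursuer's velocity as a function of (x, y, v). *)
Definition strategy (R : realType) (n : nat) :=
  'rV[R]_n -> 'rV[R]_n -> 'rV[R]_n -> 'rV[R]_n.

Definition trajectory (R : realType) (n : nat) (x0 y0 : 'rV[R]_n)
    (u : strategy R n) (v x : R -> 'rV[R]_n) : Prop :=
  let w := fun s => u (x s) (position y0 v s) (v s) in
  control w /\ forall t : R, 0 <= t -> x t = position x0 w t.

(* Against each legal evasion the strategy determines exactly one trajectory; it
   stays in [S] and comes within [eps] of Evader. *)
Definition winning (R : realType) (n : nat) (S : set 'rV[R]_n) (eps : R)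
    (x0 y0 : 'rV[R]_n) (u : strategy R n) : Prop :=
  forall v : R -> 'rV[R]_n, evasion S y0 v ->
  exists x : R -> 'rV[R]_n,
    [/\ trajectory x0 y0 u v x,
        forall x' : R -> 'rV[R]_n, trajectory x0 y0 u v x' ->
          forall t : R, 0 <= t -> x' t = x t,
        stays_in S x &
        exists2 t : R, 0 <= t & enorm (x t - position y0 v t) <= eps].

(* Main.v *)
(** Pursuer moves with velocity [F (y - x)], where [F z = z / max (|z|, eps)]: he
    heads straight for Evader, at full speed until the distance is [eps].  Since
    [F] is Lipschitz and [y] is 1-Lipschitz, Euler's method with step [h] has an
    error of order [h], by Gronwall's inequality.  Its limit is the unique
    trajectory; it stays in [S], because each Euler step moves to a convex
    combination of the positions of the players.  Euler's method in rational
    arithmetic, with [y] replaced by Riemann sums of oracle values of [v], computes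
    the trajectory.

    For the capture let [D] bound [S] and suppose that [|z| > eps] for all times,
    where [z = y - x].  With [w = z / |z|] one has [z' = v - w] and
    [|v - w|^2 <= 2 (1 - v.w)], hence
      [(x.z - (D / eps)^2 |z|^2 / 2)'
         = |z| + x.(v - w) + (D / eps)^2 |z| (1 - v.w) >= eps / 2],
    although this function is bounded.

    The rational computation is primitive recursive in the oracles, and is
    translated into a while program whose registers are the tapes of a machine.
    The machines of [x0] and [y0] are run once each, at a precision determined
    beforehand, on tapes of their own. *)

Require Import Defs.
From HB Require Import structures.
From mathcomp Require Import all_boot all_order all_algebra.
From mathcomp Require Import all_classical all_reals all_analysis.
From mathcomp Require Import measurable_realfun.
From mathcomp Require Import zify ring lra.
Import Order.TTheory GRing.Theory Num.Theory.
Import numFieldNormedType.Exports.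
Set Implicit Arguments.
Unset Strict Implicit.
Unset Printing Implicit Defensive.
Local Open Scope classical_set_scope.
Local Open Scope ring_scope.

(** * Oracle machines built from components *)

(** The field [z / |z|] is discontinuous at [z = 0], where neither Euler's method nor Gronwall's
    inequality would apply; the cut-off acts only at distances where the game is already won. As [v]
    is merely Borel, [y] is Lipschitz but need not be differentiable at a given time. Hence no
    derivative occurs: trajectories are described by first-order expansions with an error of order
    [h^2], and uniqueness, existence, capture and accuracy all come from summing such errors over
    grids. The capture function is explained by its extreme case: if Evader flees along [w], then
    [z] is constant and [x.z] grows because Pursuer moves along [z]; every deviation shrinks [|z|],
    which the second term rewards enough to pay for the change of [x.z]. The machines of [x0] and
    [y0] halt after unknown times, so they cannot be folded into a primitive recursive term and are
    run unchanged. The precision asked from them depends only on the requested accuracy and a bound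
    for the time. *)

Section Components.
Local Open Scope nat_scope.
Variables (m : nat) (sym : finType) (tapes : nat).
Variables (blank one : sym).
Variable O : m.-tuple (nat -> nat).
Hypothesis one_neq_blank : one != blank.

Local Notation tape := ('I_tapes.+2).
Local Notation content := (seq sym * seq sym)%type.
Local Notation contents := ({ffun tape -> content}).

Definition ask_tape : tape := ord0.
Definition ans_tape : tape := lift ord0 ord0.

Definition content_act (T : content) (a : sym * tm_move) : content :=
  match a.2 with
  | MoveL => (behead T.1, head blank T.1 :: a.1 :: behead T.2)
  | Stay => (T.1, a.1 :: behead T.2)
  | MoveR => (a.1 :: T.1, behead T.2)
  end.

(* A register is a tape whose value is the run of ones under its head, whatever
   else is on the tape; this is why no tape ever has to be erased. *)
Definition content_nat (T : content) : nat := find (predC1 one) T.2.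

(* An embedded machine can be started on clean tapes only. *)
Definition clean (T : content) : bool :=
  all (pred1 blank) T.1 && all (pred1 blank) (drop (content_nat T) T.2).

(* [None] is the exit of a component. *)
Record component := Component {
  cstate : finType;
  cstart : cstate;
  cprog : cstate -> tm_instr m (option cstate) sym tape
}.

Definition instr_step (Q : Type) (S : finType) (i : tm_instr m S sym tape)
    (f : S -> Q) (q : Q) (T : contents) : Q * contents :=
  match i with
  | Halt => (q, T)
  | Query k s =>
      (f s, [ffun j => if j == ans_tape
                       then ([::], nseq (tnth O k (content_nat (T ask_tape))) one)
                       else T j])
  | Act delta =>
      let r := delta [ffun j => head blank (T j).2] in
      (f r.1, [ffun j => content_act (T j) (r.2 j)])
  end.

Definition cstep (c : component) (x : option (cstate c) * contents) :=
  if x.1 is Some q then instr_step (cprog q) id x.1 x.2 else x.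

Definition reach c x y := exists t, iter t (@cstep c) x = y.

Definition runs c T T' := @reach c (Some (cstart c), T) (None, T').

Lemma reach_refl c x : @reach c x x. Proof. by exists 0. Qed.

Lemma reach_trans c y x z : @reach c x y -> reach y z -> reach x z.
Proof. by move=> [t <-] [u <-]; exists (u + t); rewrite iterD. Qed.

Lemma reach_step c x z : @reach c (cstep x) z -> reach x z.
Proof. by move=> [t <-]; exists t.+1; rewrite iterSr. Qed.

Definition map_instr (S S' : finType) (f : S -> S') (i : tm_instr m S sym tape) :
    tm_instr m S' sym tape :=
  match i with
  | Halt => Halt _ _ _ _
  | Query k s => Query _ _ k (f s)
  | Act d => Act _ (fun r => (f (d r).1, (d r).2))
  end.

Lemma instr_step_map (Q Q' : Type) (S S' : finType) (f : S -> S') (g : S -> Q)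
    (g' : S' -> Q') (h : Q -> Q') i q T :
  (forall s, g' (f s) = h (g s)) ->
  instr_step (map_instr f i) g' (h q) T =
  (h (instr_step i g q T).1, (instr_step i g q T).2).
Proof. by move=> E; case: i => //= [k s|d]; rewrite E. Qed.

(** [h None] need not be an exit: in [cseq] the exit of the first component becomes the start of the
    second, in [cwhile] the exit of the body becomes the loop test. *)
Lemma reach_map c c' (h : option (cstate c) -> option (cstate c')) :
  (forall q, exists2 q', h (Some q) = Some q' & cprog q' = map_instr h (cprog q)) ->
  forall x T', reach x (None, T') -> @reach c' (h x.1, x.2) (h None, T').
Proof.
move=> hP x T' [t]; elim: t x => [|t IH] [[q|] T] /=.
- by [].
- by case=> <-; apply: reach_refl.
- rewrite -iterS iterSr => /IH R; apply: reach_step; move: R.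
  have [q' hq pq] := hP q.
  have -> // : cstep (h (Some q), T) = (h (cstep (Some q, T)).1, (cstep (Some q, T)).2).
  rewrite hq /cstep /= pq -hq.
  by rewrite (@instr_step_map _ _ _ _ h id id h).
by rewrite -iterS iterSr => /(IH (None, T)).
Qed.

Definition cseq (c1 c2 : component) : component :=
  @Component (cstate c1 + cstate c2)%type (inl (cstart c1))
    (fun q => match q with
     | inl q => map_instr (fun o => Some (oapp inl (inr (cstart c2)) o)) (cprog q)
     | inr q => map_instr (omap inr) (cprog q)
     end).

Lemma runs_seq c1 c2 T T' T'' :
  runs c1 T T' -> runs c2 T' T'' -> runs (cseq c1 c2) T T''.
Proof.
move=> r1 r2.
apply: (@reach_trans (cseq c1 c2) (Some (inr (cstart c2)), T')).
  pose h (o : option (cstate c1)) : option (cstate (cseq c1 c2)) :=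
    Some (oapp inl (inr (cstart c2)) o).
  apply: (@reach_map _ _ h _ _ _ r1) => q.
  by exists (inl q).
pose h (o : option (cstate c2)) : option (cstate (cseq c1 c2)) := omap inr o.
by apply: (@reach_map _ _ h _ _ _ r2) => q; exists (inr q).
Qed.

Definition cact (d : {ffun tape -> sym} -> tape -> sym * tm_move) : component :=
  @Component unit tt (fun _ => Act _ (fun r => (None, d r))).

Lemma runs_act d (T : contents) :
  runs (cact d) T
    [ffun j => content_act (T j) (d [ffun j => head blank (T j).2] j)].
Proof. by exists 1. Qed.

Definition cask (i : 'I_m) : component :=
  @Component unit tt (fun _ => Query _ _ i None).

Definition cwhile (r : tape) (c : component) : component :=
  @Component (option (cstate c)) None
    (fun q => match q with
     | Some q => map_instr some (cprog q)
     | None => Act _ (fun rd =>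
         (if rd r == one then Some (Some (cstart c)) else None,
          fun j => (rd j, Stay)))
     end).

(** An [Act] writes on every tape, and writing back what was read can make a blank explicit. Hence
    idle tapes are preserved in value and cleanness, but not as pairs of lists. *)
Definition refresh (T : contents) : contents :=
  [ffun j => content_act (T j) (head blank (T j).2, Stay)].

Lemma refreshE (T : contents) :
  [ffun j => content_act (T j) ([ffun i => head blank (T i).2] j, Stay)] = refresh T.
Proof. by apply/ffunP => j; rewrite !ffunE. Qed.

Lemma runs_while_stop r c (T : contents) :
  head blank (T r).2 != one -> runs (cwhile r c) T (refresh T).
Proof.
move=> H; exists 1; by rewrite /= /cstep /= ffunE (negPf H) refreshE.
Qed.

Lemma runs_while_step r c (T T' T'' : contents) :
  head blank (T r).2 = one ->
  runs c (refresh T) T' -> runs (cwhile r c) T' T'' -> runs (cwhile r c) T T''.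
Proof.
move=> H r1 r2; apply: reach_step; rewrite /cstep /= ffunE H eqxx refreshE.
apply: reach_trans r2.
pose h (o : option (cstate c)) : option (cstate (cwhile r c)) := Some o.
by apply: (@reach_map _ _ h _ _ _ r1) => q; exists (Some q).
Qed.

Inductive cmd :=
| Inc of nat
| Dec of nat
| Seq of cmd & cmd
| While of nat & cmd
| Ask of 'I_m.

Definition upd (s : nat -> nat) (r v : nat) : nat -> nat :=
  fun x => if x == r then v else s x.

Inductive exec : cmd -> (nat -> nat) -> (nat -> nat) -> Prop :=
| EInc r s : exec (Inc r) s (upd s r (s r).+1)
| EDec r s : exec (Dec r) s (upd s r (s r).-1)
| ESeq c1 c2 s s' s'' : exec c1 s s' -> exec c2 s' s'' -> exec (Seq c1 c2) s s''
| EWhile0 r c s : s r = 0 -> exec (While r c) s s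
| EWhileS r c s s' s'' :
    s r != 0 -> exec c s s' -> exec (While r c) s' s'' -> exec (While r c) s s''
| EAsk i s : exec (Ask i) s (upd s 1 (tnth O i (s 0))).

Definition keep_or (r : tape) (a : sym -> sym * tm_move) (rd : {ffun tape -> sym})
    (j : tape) : sym * tm_move :=
  if j == r then a (rd j) else (rd j, Stay).

(** Numbers change at their left end, under the head: [Inc] steps left and overwrites that cell,
    whatever it holds; [Dec] leaves a blank behind, so that cleanness survives. *)
Fixpoint compile (c : cmd) : component :=
  match c with
  | Inc r => cseq (cact (keep_or (inord r) (fun x => (x, MoveL))))
                  (cact (keep_or (inord r) (fun=> (one, Stay))))
  | Dec r => cact (keep_or (inord r)
               (fun x => if x == one then (blank, MoveR) else (x, Stay)))
  | Seq c1 c2 => cseq (compile c1) (compile c2)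
  | While r c => cwhile (inord r) (compile c)
  | Ask i => cask i
  end.

Fixpoint cmd_bound (c : cmd) : nat :=
  match c with
  | Inc r | Dec r => r.+1
  | Seq c1 c2 => maxn (cmd_bound c1) (cmd_bound c2)
  | While r c => maxn r.+1 (cmd_bound c)
  | Ask i => 0
  end.

Definition stores (T : contents) (s : nat -> nat) : Prop :=
  forall i : tape, content_nat (T i) = s i.

Definition keeps_clean (T T' : contents) : Prop :=
  forall i, clean (T i) -> clean (T' i).

Lemma blank_one : (blank == one) = false.
Proof. by rewrite eq_sym; apply: negPf. Qed.

Lemma content_nat_stay T :
  content_nat (content_act T (head blank T.2, Stay)) = content_nat T.
Proof. by case: T => L [|x R]; rewrite /content_nat //= blank_one. Qed.

Lemma clean_stay T : clean T -> clean (content_act T (head blank T.2, Stay)).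
Proof.
rewrite /clean content_nat_stay; case: T => L [|x R] //=.
by move=> /andP[-> _]; rewrite eqxx.
Qed.

Lemma clean_push T : clean T -> clean (behead T.1, one :: head blank T.2 :: behead T.2).
Proof.
case: T => L [|x R]; rewrite /clean /content_nat /= !eqxx /=.
  by rewrite blank_one /= eqxx; case: L => //= ? ? /andP[/andP[_ ->]].
by move=> /andP[cL ->]; case: L cL => //= ? ? /andP[_ ->].
Qed.

Lemma head_one T : (head blank T.2 == one) = (content_nat T != 0).
Proof.
case: T => L [|x R]; rewrite /content_nat /=; first by rewrite blank_one.
by case: eqP.
Qed.

Lemma stores_refresh T s : stores T s -> stores (refresh T) s.
Proof. by move=> H i; rewrite ffunE content_nat_stay. Qed.

Lemma keeps_clean_refresh T : keeps_clean T (refresh T).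
Proof. by move=> i; rewrite ffunE; apply: clean_stay. Qed.

Lemma keep_orE r a rd (j : tape) : r < tapes.+2 ->
  keep_or (inord r) a rd j = if j == r :> nat then a (rd j) else (rd j, Stay).
Proof. by move=> H; rewrite /keep_or -val_eqE /= inordK. Qed.

(** Cleanness is part of the invariant because some registers later serve as tapes of an embedded
    machine, which must find them as if freshly initialised. *)
Lemma compile_sound c s s' : exec c s s' -> cmd_bound c <= tapes.+2 ->
  forall T, stores T s ->
  exists T', [/\ runs (compile c) T T', stores T' s' & keeps_clean T T'].
Proof.
elim=> {c s s'} [r s|r s|c1 c2 s s' s'' _ IH1 _ IH2|r c s s0|r c s s' s'' s0 _ IH1 _ IH2|i s]
  /= lb T sT.
- eexists; split; first by apply: runs_seq; apply: runs_act.
    move=> j; rewrite /upd !(ffunE, keep_orE _ _ _ lb); case: ifP => [/eqP <-|_].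
      rewrite -sT /=; case: (T j) => L [|x R]; rewrite /content_nat /= eqxx //=.
      by rewrite blank_one.
    by rewrite !content_nat_stay.
  move=> j cj; rewrite !(ffunE, keep_orE _ _ _ lb); case: ifP => _.
    exact: clean_push.
  by do 2!apply: clean_stay.
- eexists; split; first exact: runs_act.
    move=> j; rewrite /upd !(ffunE, keep_orE _ _ _ lb); case: ifP => [/eqP <-|_].
      rewrite head_one -sT; have [|E] := boolP (content_nat (T j) != 0).
        by case: (T j) => L [|x R]; rewrite /content_nat //=; case: (x == one).
      by rewrite content_nat_stay; case: content_nat E.
    by rewrite content_nat_stay.
  move=> j cj; rewrite !(ffunE, keep_orE _ _ _ lb); case: ifP => _; last exact: clean_stay.
  rewrite head_one; have [|E] := boolP (content_nat (T j) != 0); last exact: clean_stay.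
  by move: cj; rewrite /clean; case: (T j) => L [|x R]; rewrite /content_nat //=;
    case: (x == one); rewrite //= eqxx.
- move: lb; rewrite geq_max => /andP[lb1 lb2].
  have [T1 [r1 s1 k1]] := IH1 lb1 _ sT.
  have [T2 [r2 s2 k2]] := IH2 lb2 _ s1.
  exists T2; split=> //; first exact: runs_seq r1 r2.
  by move=> i /k1 /k2.
- move: lb; rewrite geq_max => /andP[lb1 lb2].
  exists (refresh T); split.
  + by apply: runs_while_stop; rewrite head_one sT inordK // s0.
  + exact: stores_refresh.
  + exact: keeps_clean_refresh.
- have /andP[lb1 lb2] : (r.+1 <= tapes.+2) && (cmd_bound c <= tapes.+2).
    by rewrite -geq_max.
  have [T1 [r1 s1 k1]] := IH1 lb2 _ (stores_refresh sT).
  have [|T2 [r2 s2 k2]] := IH2 _ _ s1; first by rewrite geq_max lb1.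
  exists T2; split=> //.
  + apply: runs_while_step r1 r2.
    by apply/eqP; rewrite head_one sT inordK.
  + by move=> i ci; apply/k2/k1/keeps_clean_refresh.
- eexists; split; first by exists 1.
    move=> j; rewrite ffunE /upd -val_eqE /=.
    case: ifP => _; last exact: sT.
    by rewrite sT /content_nat /=; elim: (tnth _ _ _) => //= k ->; rewrite eqxx.
  move=> j cj; rewrite ffunE; case: ifP => // _.
  rewrite /clean /=; set k := tnth _ _ _; apply/allP => x.
  have -> : content_nat ([::], nseq k one) = k.
    by rewrite /content_nat /=; elim: k => //= k ->; rewrite eqxx.
  by rewrite drop_oversize ?size_nseq.
Qed.

Section Embed.
Variables (M : oracle_tm 0) (emb : tm_sym M -> sym) (proj : sym -> tm_sym M).
Variable place : tm_tape M -> tape.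
Hypothesis embK : cancel emb proj.
Hypothesis emb_blank : emb (tm_blank M) = blank.
Hypothesis emb_one : emb (tm_one M) = one.
Hypothesis place_inj : injective place.

(* [M] has no oracles, so that its [Query] branch is empty. *)
Definition cembed : component :=
  @Component (tm_state M) (tm_start M) (fun q =>
    match tm_prog q with
    | Halt => Act _ (fun rd => (None, fun j => (rd j, Stay)))
    | Query _ _ => Halt _ _ _ _
    | Act delta => Act _ (fun rd =>
        let r := delta [ffun x => proj (rd (place x))] in
        (Some r.1, fun j => if [pick x | place x == j] is Some x
                            then (emb (r.2 x).1, (r.2 x).2) else (rd j, Stay)))
    end).

(** Cells are compared one by one with a default, since the two lists may differ by trailing
    blanks. *)
Definition emulates (T : content) (T0 : tape_content M) : Prop :=
  (forall i, nth blank T.1 i = emb (nth (tm_blank M) T0.1 i)) /\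
  (forall i, nth blank T.2 i = emb (nth (tm_blank M) T0.2 i)).

Lemma emulates_read T T0 :
  emulates T T0 -> head blank T.2 = emb (head (tm_blank M) T0.2).
Proof. by move=> [_ /(_ 0)]; rewrite !nth0. Qed.

Lemma emulates_act T T0 a d : emulates T T0 ->
  emulates (content_act T (emb a, d)) (tape_act T0 (a, d)).
Proof.
by move=> [HL HR]; case: d; split=> -[|[|i]] //=; rewrite ?nth_behead -?nth0 ?nth_behead.
Qed.

Lemma emulates_nat T T0 : emulates T T0 -> content_nat T = nat_of_tape T0.
Proof.
have oneE x : (emb x != one) = (x != tm_one M).
  by rewrite -emb_one (inj_eq (can_inj embK)).
case: T T0 => L R [L0 R0] [_ /=]; rewrite /content_nat /nat_of_tape /= => H.
elim: R R0 H => [|x R IH] [|x0 R0] //= H.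
- have := H 0 => /= E; rewrite /= -oneE -E eq_sym one_neq_blank //.
- by have := H 0 => /= ->; rewrite emb_blank eq_sym one_neq_blank.
- have := H 0 => /= ->; rewrite oneE; case: ifP => // _; congr _.+1.
  by apply: IH => i; have := H i.+1.
Qed.

Lemma clean_emulates T k : clean T -> content_nat T = k ->
  emulates T (tape_of_nat M k).
Proof.
case: T => L R; rewrite /clean /content_nat /= => /andP[/all_nthP cL cR] E.
split=> /= i.
  rewrite nth_nil emb_blank; have [iL|iL] := ltnP i (size L); last exact: nth_default.
  by have /= /eqP := cL blank i iL.
rewrite nth_nseq; elim: R k i E cR => [|x R IH] k i /=.
  by move=> <- _; rewrite nth_nil ltn0 emb_blank.
have [->|xo] /= := eqVneq x one.
  by move=> <-; case: i => [|i] //= cR; apply: IH.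
move=> <- /andP[/eqP -> cR]; rewrite ltn0 emb_blank; case: i => //= i.
have [iR|iR] := ltnP i (size R); last exact: nth_default.
by have /all_nthP/(_ i iR)/eqP := cR.
Qed.

Definition agrees (T : contents) (c : config M) : Prop :=
  forall x, emulates (T (place x)) (c.2 x).

(** The last clause is the frame condition for running two machines in a row: the first leaves the
    tapes of the second clean, and the second leaves the output of the first readable. *)
Lemma cembed_sound t (c : config M) (T : contents) (c' := iter t (tm_step [tuple]) c) :
  halted c' -> agrees T c ->
  exists T', [/\ reach (c := cembed) (Some c.1, T) (None, T'),
    content_nat (T' (place (tm_out M))) = nat_of_tape (c'.2 (tm_out M)) &
    forall j, (forall x, place x != j) ->
      content_nat (T' j) = content_nat (T j) /\ (clean (T j) -> clean (T' j))].
Proof.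
rewrite {}/c'; elim: t c T => [|t IH] c T.
  move=> /= hc ag; exists (refresh T); split.
  - by apply: reach_step; rewrite /cstep /= hc /= refreshE; apply: reach_refl.
  - by rewrite ffunE content_nat_stay (emulates_nat (ag _)).
  - by move=> j _; rewrite ffunE content_nat_stay; split=> // /clean_stay.
rewrite iterSr => ht ag; move: ht; rewrite {2 4}/tm_step.
(* A halted configuration repeats itself until time [t]; these idle steps have no counterpart in the
   component. *)
case E: (tm_prog c.1) => [|[]//|delta] ht; first exact: IH ht ag.
set r := delta _ in ht *.
pose T1 : contents := [ffun j => content_act (T j)
   (if [pick x | place x == j] is Some x
    then (emb (r.2 x).1, (r.2 x).2) else (head blank (T j).2, Stay))].
have [x|T2 [r2 o2 k2]] := IH _ T1 ht.
  rewrite /= !ffunE; case: pickP => [y /eqP /place_inj ->|/(_ x)]; last by rewrite eqxx.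
  by rewrite [r.2 x]surjective_pairing; apply: emulates_act.
exists T2; split=> //.
  apply: reach_step; rewrite /cstep /= E /=.
  have -> : [ffun x => proj ([ffun j => head blank (T j).2] (place x))] =
            [ffun j => tape_read (c.2 j)].
    by apply/ffunP => x; rewrite !ffunE (emulates_read (ag x)) embK.
  rewrite -/r; set T1' := finfun _; suff -> : T1' = T1 by [].
  by apply/ffunP => j; rewrite !ffunE.
move=> j jP; have [-> cl] := k2 j jP; rewrite ffunE.
case: pickP => [x /eqP xj|_]; first by have := jP x; rewrite xj eqxx.
by rewrite content_nat_stay; split=> // /clean_stay cj; apply: cl; rewrite ffunE;
  case: pickP => [x /eqP xj|_] //; have := jP x; rewrite xj eqxx.
Qed.

End Embed.

End Components.
(** * Primitive recursion relative to oracles *)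

Section Terms.
Local Open Scope nat_scope.
Variable m : nat.

(* Variables are de Bruijn indices.  The body of [TIter] sees the loop index as
   variable 0 and the current value as variable 1. *)
Inductive term :=
| TVar of nat
| TZero
| TSucc of term
| TOracle of 'I_m & term
| TLet of term & term
| TIter of term & term & term
| TShift of term.

Fixpoint eval (O : m.-tuple (nat -> nat)) (t : term) (s : seq nat) : nat :=
  match t with
  | TVar i => nth 0 s i
  | TZero => 0
  | TSucc t => (eval O t s).+1
  | TOracle i t => tnth O i (eval O t s)
  | TLet a t => eval O t (eval O a s :: s)
  | TIter k a g =>
      iteri (eval O k s) (fun i acc => eval O g [:: i, acc & s]) (eval O a s)
  | TShift t => eval O t (behead s)
  end.

Definition clear_reg r : cmd m := While r (Dec m r).
Definition move_reg r d : cmd m := While r (Seq (Dec m r) (Inc m d)).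
Definition move_reg2 r d e : cmd m := While r (Seq (Dec m r) (Seq (Inc m d) (Inc m e))).

(* The code for [t] reads its variables in the registers listed in [rho], leaves
   its value in register [b] and uses the registers from [b] on as scratch
   space; registers 0 and 1 are the query and answer tapes. *)
Fixpoint code_of (t : term) (rho : seq nat) (b : nat) : cmd m :=
  match t with
  | TVar i =>
      Seq (clear_reg b)
        (if i < size rho then
           Seq (clear_reg b.+1)
             (Seq (move_reg2 (nth 0 rho i) b b.+1) (move_reg b.+1 (nth 0 rho i)))
         else clear_reg b)
  | TZero => clear_reg b
  | TSucc t => Seq (code_of t rho b) (Inc m b)
  | TOracle i t =>
      Seq (code_of t rho b)
        (Seq (clear_reg 0) (Seq (move_reg b 0) (Seq (Ask i) (move_reg 1 b))))
  | TLet a t =>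
      Seq (code_of a rho b)
        (Seq (code_of t (b :: rho) b.+1) (Seq (clear_reg b) (move_reg b.+1 b)))
  | TIter k a g =>
      Seq (code_of k rho b)
        (Seq (code_of a rho b.+1)
          (Seq (clear_reg b.+2)
            (Seq (While b (Seq (Dec m b)
                   (Seq (code_of g [:: b.+2, b.+1 & rho] b.+3)
                     (Seq (clear_reg b.+1) (Seq (move_reg b.+3 b.+1) (Inc m b.+2))))))
                 (move_reg b.+1 b))))
  | TShift t => code_of t (behead rho) b
  end.

Variable O : m.-tuple (nat -> nat).
Local Notation exec := (exec O).

Definition moved (r : nat) (D : pred nat) (s : nat -> nat) : nat -> nat :=
  fun x => if x == r then 0 else if D x then s x + s r else s x.

Lemma exec_clear r s : exec (clear_reg r) s (upd s r 0).
Proof.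
move sr: (s r) => k; elim: k s sr => [|k IH] s sr.
  have -> : upd s r 0 = s by apply/funext => x; rewrite /moved /upd; case: eqP => // ->.
  exact: EWhile0.
apply: EWhileS; [by rewrite sr|exact: EDec|].
have -> : upd s r 0 = upd (upd s r (s r).-1) r 0.
  by apply/funext => x; rewrite /moved /upd; case: eqP.
by apply: IH; rewrite /moved /upd eqxx sr.
Qed.

Lemma exec_move_reg2 r d e s : r != d -> r != e -> d != e ->
  exec (move_reg2 r d e) s (moved r (pred2 d e) s).
Proof.
move=> rd re de; set f := moved _ _.
move sr: (s r) => k; elim: k s sr => [|k IH] s sr.
  suff -> : f s = s by apply: EWhile0.
  by apply/funext => x; rewrite /f /moved sr addn0; case: eqP => [->|_] //; case: ifP.
apply: EWhileS; [by rewrite sr| |].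
  by apply: ESeq; [exact: EDec|apply: ESeq; exact: EInc].
set s1 := upd _ _ _; have s1E x : s1 x = if x == r then k
    else if (x == d) || (x == e) then (s x).+1 else s x.
  rewrite /s1 /upd sr /=; have [->|xe] := eqVneq x e.
    by rewrite !(eq_sym e) (negPf re) (negPf de) orbT.
  have [->|xd] := eqVneq x d; first by rewrite (eq_sym d) (negPf rd).
  by [].
suff -> : f s = f s1 by apply: IH; rewrite s1E eqxx.
apply/funext => x; rewrite /f /moved /= !s1E eqxx sr; case: eqP => // _.
by case: ifP => // _; rewrite addSnnS.
Qed.

Lemma exec_move_reg r d s : r != d ->
  exec (move_reg r d) s (moved r (pred1 d) s).
Proof.
move=> rd; set f := moved _ _.
move sr: (s r) => k; elim: k s sr => [|k IH] s sr.
  suff -> : f s = s by apply: EWhile0.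
  by apply/funext => x; rewrite /f /moved /= sr addn0; case: eqP => [->|_] //; case: ifP.
apply: EWhileS; [by rewrite sr| |].
  by apply: ESeq; [exact: EDec|exact: EInc].
set s1 := upd _ _ _; have s1E x : s1 x = if x == r then k
    else if x == d then (s x).+1 else s x.
  rewrite /s1 /upd sr /=; have [->|xd] := eqVneq x d => //.
  by rewrite (eq_sym d) (negPf rd).
suff -> : f s = f s1 by apply: IH; rewrite s1E eqxx.
apply/funext => x; rewrite /f /moved /= !s1E eqxx sr; case: eqP => // _.
by case: ifP => // _; rewrite addSnnS.
Qed.

Lemma code_ofP t rho b s : 1 < b -> (forall r, r \in rho -> 1 < r < b) ->
  exists s', [/\ exec (code_of t rho b) s s',
    s' b = eval O t (map s rho) & forall r, 1 < r < b -> s' r = s r].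
Proof.
have mapE (s1 s2 : nat -> nat) b0 rh : (forall r, 1 < r < b0 -> s2 r = s1 r) ->
    (forall r, r \in rh -> 1 < r < b0) -> map s2 rh = map s1 rh.
  by move=> E rP; apply/eq_in_map => r /rP /E.
have less r b0 : 1 < r < b0 -> 1 < r < b0.+1.
  by move=> /andP[-> /= ?]; apply: ltnW.
elim: t rho b s => [i||t IH|i t IH|a IHa t IHt|k IHk a IHa g IHg|t IH] rho b s b1 rhoP /=.
- have [ir|ir] := ltnP i (size rho); last first.
    exists (upd (upd s b 0) b 0); split; first by apply: ESeq; apply: exec_clear.
      by rewrite nth_default ?size_map // /upd eqxx.
    by move=> r /andP[_ rb]; rewrite /moved /upd ltn_eqF.
  set r0 := nth 0 rho i; have /andP[r1 rb] : 1 < r0 < b by apply/rhoP/mem_nth.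
  eexists; split.
  + apply: ESeq; first exact: exec_clear.
    apply: ESeq; first exact: exec_clear.
    apply: ESeq; first by apply: exec_move_reg2; lia.
    by apply: exec_move_reg; lia.
  + rewrite (nth_map 0) // -/r0 /moved /upd /= !eqxx.
    have -> : (b == b.+1) = false by lia.
    have -> : (b == r0) = false by lia.
    have -> : (r0 == b) = false by lia.
    by have -> /= : (r0 == b.+1) = false by lia.
  + move=> r /andP[r2 r3]; rewrite /moved /upd /= !eqxx.
    have -> : (r == b.+1) = false by lia.
    have -> : (b.+1 == r0) = false by lia.
    have -> : (r == b) = false by lia.
    have -> : (b.+1 == b) = false by lia.
    have -> : (r0 == b) = false by lia.
    have -> : (r0 == b.+1) = false by lia.
    by rewrite orbT /= add0n; case: eqP => // ->; lia.
- exists (upd s b 0); split; [exact: exec_clear|by rewrite /moved /upd eqxx|].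
  by move=> r /andP[_ rb]; rewrite /moved /upd ltn_eqF.
- have [s1 [e1 v1 k1]] := IH rho b s b1 rhoP.
  exists (upd s1 b (s1 b).+1); split.
  + by apply: ESeq e1 _; apply: EInc.
  + by rewrite /moved /upd eqxx v1.
  + move=> r rb; rewrite /upd; case: eqP => [?|_]; [lia|exact: k1].
- have [s1 [e1 v1 k1]] := IH rho b s b1 rhoP.
  eexists; split.
  + apply: ESeq e1 _; apply: ESeq; first exact: exec_clear.
    apply: ESeq; first by apply: exec_move_reg; lia.
    apply: ESeq; first exact: EAsk.
    by apply: exec_move_reg; lia.
  + rewrite /moved /upd /= !eqxx.
    have -> : (b == 1) = false by lia.
    have -> : (0 == b) = false by lia.
    have -> : (b == 0) = false by lia.
    by rewrite !add0n v1.
  + move=> r /andP[r2 r3]; rewrite /moved /upd /=.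
    have -> : (r == 1) = false by lia.
    have -> : (r == b) = false by lia.
    have -> : (r == 0) = false by lia.
    by apply: k1; rewrite r2.
- have [s1 [e1 v1 k1]] := IHa rho b s b1 rhoP.
  have [||s2 [e2 v2 k2]] := IHt (b :: rho) b.+1 s1; first exact: ltnW.
    move=> r; rewrite inE => /orP[/eqP ->|/rhoP/less //]; by rewrite b1 /=.
  eexists; split.
  + apply: ESeq e1 _; apply: ESeq e2 _; apply: ESeq; first exact: exec_clear.
    by apply: exec_move_reg; lia.
  + rewrite /moved /upd /= !eqxx.
    have -> : (b == b.+1) = false by lia.
    have -> : (b.+1 == b) = false by lia.
    by rewrite v2 /= v1 (mapE s s1 b).
  + move=> r /andP[r2 r3]; rewrite /moved /upd /=.
    have -> : (r == b.+1) = false by lia.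
    have -> : (r == b) = false by lia.
    by rewrite k2 ?k1 ?r2 //= ltnW.
- have [s1 [e1 v1 k1]] := IHk rho b s b1 rhoP.
  have rhoP1 r : r \in rho -> 1 < r < b.+1 by move/rhoP/less.
  have [s2 [e2 v2 k2]] := IHa rho b.+1 s1 (ltnW b1) rhoP1.
  pose F i acc := eval O g [:: i, acc & map s rho].
  pose A := eval O a (map s rho).
  have [s4 [e4 v4 z4 k4]] : exists s4, [/\ exec (While b (Seq (Dec m b)
         (Seq (code_of g [:: b.+2, b.+1 & rho] b.+3)
           (Seq (clear_reg b.+1) (Seq (move_reg b.+3 b.+1) (Inc m b.+2))))))
         (upd s2 b.+2 0) s4,
      s4 b.+1 = iteri (eval O k (map s rho)) F A, s4 b = 0
      & forall r, 1 < r < b -> s4 r = s r].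
    (* Loop invariant, stated before the store is generalised: register [b.+1] holds the iterate
       whose index is in [b.+2], and [b.+2] plus the countdown in [b] is the number of rounds. *)
    have: (upd s2 b.+2 0) b.+1 = iteri ((upd s2 b.+2 0) b.+2) F A.
      by rewrite /moved /upd !eqxx /= (ltn_eqF (ltnSn _)) v2 (mapE s s1 b).
    have: eval O k (map s rho) = (upd s2 b.+2 0) b.+2 + (upd s2 b.+2 0) b.
      rewrite /moved /upd eqxx; have -> : (b == b.+2) = false by lia.
      by rewrite -v1 k2 // b1 /=.
    have: forall r, 1 < r < b -> (upd s2 b.+2 0) r = s r.
      move=> r /andP[r2 r3]; rewrite /moved /upd; have -> : (r == b.+2) = false by lia.
      by rewrite k2 ?k1 ?r2 //= ltnW.
    move: (upd s2 b.+2 0) => s3 k3 n3 v3; move bN: (s3 b) => N.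
    elim: N s3 bN k3 n3 v3 => [|N IHN] s3 bN k3 n3 v3.
      by exists s3; split=> //; [exact: EWhile0|rewrite n3 bN addn0].
    pose s4 := upd s3 b (s3 b).-1.
    have [||s5 [e5 v5 k5]] := IHg [:: b.+2, b.+1 & rho] b.+3 s4; first by lia.
      by move=> r; rewrite !inE => /or3P[/eqP ->|/eqP ->|/rhoP ?]; lia.
    have s43 r : b < r -> s4 r = s3 r by move=> br; rewrite /s4 /upd gtn_eqF.
    have s4b : s4 b = N by rewrite /s4 /upd eqxx bN.
    have s34 : map s4 rho = map s rho.
      apply: (mapE _ _ b) => // r rb; rewrite /s4 /upd; case: eqP => [E|_]; last exact: k3.
      by lia.
    pose s6 x := if x == b.+3 then 0 else if x == b.+1 then s5 b.+3 else
      if x == b.+2 then (s5 b.+2).+1 else s5 x.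
    have [||||s7 [e7 v7 z7 k7]] := IHN s6.
    + rewrite /s6; have -> : (b == b.+3) = false by lia.
      have -> : (b == b.+1) = false by lia.
      have -> : (b == b.+2) = false by lia.
      by rewrite k5 ?s4b // b1 /= ltnW // ltnW.
    + move=> r rb; rewrite /s6; have -> : (r == b.+3) = false by lia.
      have -> : (r == b.+1) = false by lia.
      have -> : (r == b.+2) = false by lia.
      rewrite k5; last by lia.
      rewrite /s4 /upd; have -> : (r == b) = false by lia.
      exact: k3.
    + rewrite /s6 eqxx; have -> : (b.+2 == b.+3) = false by lia.
      have -> : (b.+2 == b.+1) = false by lia.
      have -> : (b == b.+3) = false by lia.
      have -> : (b == b.+1) = false by lia.
      have -> : (b == b.+2) = false by lia.
      rewrite n3 !k5; try lia.
      by rewrite s4b bN s43 ?addSnnS.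
    + rewrite /s6 !eqxx; have -> : (b.+1 == b.+3) = false by lia.
      have -> : (b.+2 == b.+3) = false by lia.
      have -> : (b.+2 == b.+1) = false by lia.
      rewrite v5 k5; last by lia.
      by rewrite /= s34 !s43 // v3.
    + exists s7; split=> //.
      apply: EWhileS e7; first by rewrite bN.
      apply: ESeq; first exact: EDec.
      apply: ESeq; first exact: e5.
      apply: ESeq; first exact: exec_clear.
      apply: ESeq; first by apply: exec_move_reg; lia.
      suff -> : s6 = upd (moved b.+3 (pred1 b.+1) (upd s5 b.+1 0)) b.+2
          (moved b.+3 (pred1 b.+1) (upd s5 b.+1 0) b.+2).+1.
        exact: EInc.
      apply/funext => x; rewrite /s6 /moved /upd /=.
      have -> : (b.+2 == b.+1) = false by lia.
      have -> : (b.+3 == b.+1) = false by lia.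
      have -> : (b.+2 == b.+3) = false by lia.
      have [->|x2] := eqVneq x b.+2.
        have -> : (b.+2 == b.+3) = false by lia.
        by have -> : (b.+2 == b.+1) = false by lia.
      by case: ifP => // _; case: ifP.
  eexists; split.
  + apply: ESeq e1 _; apply: ESeq e2 _; apply: ESeq; first exact: exec_clear.
    apply: ESeq; first exact: e4.
    by apply: exec_move_reg; lia.
  + rewrite /moved /=; have -> : (b == b.+1) = false by lia.
    by rewrite eqxx z4 v4.
  + move=> r /andP[r2 r3]; rewrite /moved /=.
    have -> : (r == b.+1) = false by lia.
    have -> : (r == b) = false by lia.
    by apply: k4; rewrite r2.
- by have [s1 [e1 v1 k1]] := IH (behead rho) b s b1 (fun r h => rhoP r (mem_behead h));
    exists s1; rewrite behead_map.
Qed.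

End Terms.

(** * A machine assembled from two given machines and two terms *)

Section Machine.
Local Open Scope nat_scope.
Variables (m : nat) (sym : finType) (tapes : nat) (blank one : sym).
Variables (one_neq_blank : one != blank) (inp out : 'I_tapes.+2).
Variable c : component m sym tapes.

Definition machine_of : oracle_tm m :=
  OracleTM one_neq_blank inp out (ask_tape tapes) (ans_tape tapes)
    (Some (cstart c)) (fun o => if o is Some q then cprog q else Halt _ _ _ _).

Lemma machine_of_step O x :
  tm_step (M := machine_of) O x = cstep blank one O (c := c) x.
Proof. by case: x => [[q|] T]; rewrite /tm_step /cstep //=; case: (cprog q). Qed.

Lemma machine_of_outputs O a T :
  runs blank one O c (@tm_init m machine_of a).2 T ->
  tm_outputs machine_of O a (content_nat one (T out)).
Proof.
move=> [t Et]; exists t.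
suff -> : iter t (tm_step (M := machine_of) O) (tm_init machine_of a) = (None, T) by [].
by rewrite -Et; apply: eq_iter => x; exact: machine_of_step.
Qed.

End Machine.

Section Assembly.
Local Open Scope nat_scope.
Variables (m : nat) (t1 t2 : term m) (Mx My : oracle_tm 0).

(** Tapes 0 to 3 are for queries, answers, input and output; then come the tapes of [Mx], those of
    [My], and from [base] on the scratch registers. *)
Let offx := 4.
Let offy := offx + #|tm_tape Mx|.
Let base := offy + #|tm_tape My|.
Let regx (i : tm_tape Mx) := offx + enum_rank i.
Let regy (i : tm_tape My) := offy + enum_rank i.

Let prog1 : cmd m := Seq (code_of t1 [:: 2] base)
  (move_reg2 m base (regx (tm_in Mx)) (regy (tm_in My))).
Let prog2 : cmd m := Seq (code_of t2 [:: 2; regx (tm_out Mx); regy (tm_out My)] base)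
  (Seq (clear_reg m 3) (move_reg m base 3)).

Let tapes := maxn base (maxn (cmd_bound prog1) (cmd_bound prog2)).
Local Notation tape := ('I_tapes.+2).

(* Both machines keep their alphabets; the letters [one] and [blank] are pairs, so
   that numbers are written in the same way on all tapes. *)
Let sym : finType := (tm_sym Mx * tm_sym My)%type.
Let blank : sym := (tm_blank Mx, tm_blank My).
Let one : sym := (tm_one Mx, tm_one My).
Let embx (a : tm_sym Mx) : sym :=
  (a, if a == tm_one Mx then tm_one My else tm_blank My).
Let emby (a : tm_sym My) : sym :=
  (if a == tm_one My then tm_one Mx else tm_blank Mx, a).
Let placex (i : tm_tape Mx) : tape := inord (regx i).
Let placey (i : tm_tape My) : tape := inord (regy i).

Let machine_core : component m sym tapes :=
  cseq (compile tapes blank one prog1)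
    (cseq (cembed m embx (@fst _ _ : sym -> tm_sym Mx) placex)
      (cseq (cembed m emby (@snd _ _ : sym -> tm_sym My) placey)
        (compile tapes blank one prog2))).

Let one_neq_blank : one != blank.
Proof. by rewrite -pair_eqE /= negb_and tm_one_neq_blank. Qed.

Let machine : oracle_tm m :=
  machine_of one_neq_blank (inord 2) (inord 3) machine_core.

Let base_tapes : base <= tapes. Proof. exact: leq_maxl. Qed.

Let prog1_tapes : cmd_bound prog1 <= tapes.
Proof. exact: leq_trans (leq_maxl _ _) (leq_maxr _ _). Qed.

Let prog2_tapes : cmd_bound prog2 <= tapes.
Proof. exact: leq_trans (leq_maxr _ _) (leq_maxr _ _). Qed.

Let regx_lt i : offx <= regx i < offy.
Proof. by rewrite leq_addr ltn_add2l ltn_ord. Qed.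

Let regy_lt i : offy <= regy i < base.
Proof. by rewrite leq_addr ltn_add2l ltn_ord. Qed.

Let placexE i : placex i = regx i :> nat.
Proof. by rewrite inordK //; have := regx_lt i; rewrite /base; lia. Qed.

Let placeyE i : placey i = regy i :> nat.
Proof. by rewrite inordK //; have := regy_lt i; lia. Qed.

Let placex_inj : injective placex.
Proof.
move=> i j /(congr1 val); rewrite /= !placexE => /addnI /val_inj.
exact: enum_rank_inj.
Qed.

Let placey_inj : injective placey.
Proof.
move=> i j /(congr1 val); rewrite /= !placeyE => /addnI /val_inj.
exact: enum_rank_inj.
Qed.

(** [t1] computes the common input of [Mx] and [My], and [t2] works on their outputs. A term could
    not simulate these machines directly: its loops have a length computed on entry, whereas the
    halting times are unknown. *)
Lemma assembled_machine : exists M : oracle_tm m, forall O j cx cy,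
  tm_outputs Mx [tuple] (eval O t1 [:: j]) cx ->
  tm_outputs My [tuple] (eval O t1 [:: j]) cy ->
  tm_outputs M O j (eval O t2 [:: j; cx; cy]).
Proof.
exists machine => O j cx cy [tx [hx ox]] [ty [hy oy]].
set k := eval O t1 _ in hx ox hy oy.
have lin := regx_lt (tm_in Mx); have lout := regx_lt (tm_out Mx).
have lin' := regy_lt (tm_in My); have lout' := regy_lt (tm_out My).
have t3 : 3 < tapes by apply: leq_trans base_tapes; lia.
have offE : offx = 4 by []. have offyE : offx <= offy by exact: leq_addr.
pose T0 : {ffun tape -> seq sym * seq sym} := (@tm_init m machine j).2.
have T0E (i : tape) : T0 i = ([::], nseq (if i == 2 :> nat then j else 0) one).
  by rewrite ffunE -val_eqE /= inordK //; lia.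
have nat0 L n0 : content_nat one (L, nseq n0 one) = n0.
  by rewrite /content_nat /=; elim: n0 => //= n0 ->; rewrite eqxx.
pose s0 := upd (fun=> 0) 2 j.
have [s1 [e1 v1 k1]] := @code_ofP m O t1 [:: 2] base s0 ltac:(lia) ltac:(by
  move=> r; rewrite inE => /eqP ->; lia).
have E1 : exec O prog1 s0 _ := ESeq e1
  (@exec_move_reg2 m O base (regx (tm_in Mx)) (regy (tm_in My)) s1
  ltac:(lia) ltac:(lia) ltac:(lia)).
have [|i|T1 [r1 st1 cl1]] := compile_sound one_neq_blank E1 _ (T := T0).
- exact: leq_trans prog1_tapes (leqW (leqnSn _)).
- by rewrite T0E nat0.
have clT1 i : clean blank one (T1 i).
  by apply: cl1; rewrite T0E /clean nat0 /= drop_oversize ?size_nseq.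
have s1k : s1 base = k by rewrite v1 /= /s0 /upd.
have s10 r : 1 < r < base -> s1 r = if r == 2 then j else 0.
  by move=> rb; rewrite k1.
have exb : embx (tm_blank Mx) = blank.
  by rewrite /embx eq_sym (negPf (tm_one_neq_blank Mx)).
have exo : embx (tm_one Mx) = one by rewrite /embx eqxx.
have eyb : emby (tm_blank My) = blank.
  by rewrite /emby eq_sym (negPf (tm_one_neq_blank My)).
have eyo : emby (tm_one My) = one by rewrite /emby eqxx.
have [|T2 [r2 o2 k2]] := @cembed_sound m _ _ blank one O one_neq_blank Mx embx
  (@fst _ _) placex (fun=> erefl) exb exo placex_inj tx (tm_init Mx k) T1 hx.
  move=> i; rewrite ffunE; apply: (clean_emulates exb exo) => //.
  have li := regx_lt i.
  rewrite st1 placexE /moved /= s1k s10; last by lia.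
  have -> : (regx i == base) = false by lia.
  have -> : (regx i == regy (tm_in My)) = false by lia.
  have -> : (regx i == 2) = false by lia.
  by rewrite orbF /regx eqn_add2l val_eqE (inj_eq enum_rank_inj).
have xout (j' : tape) : ~~ (offx <= j' < offy) -> forall i, placex i != j'.
  move=> H i; apply: contra H => /eqP <-; rewrite placexE; exact: regx_lt.
have [|T3 [r3 o3 k3]] := @cembed_sound m _ _ blank one O one_neq_blank My emby
  (@snd _ _) placey (fun=> erefl) eyb eyo placey_inj ty (tm_init My k) T2 hy.
  move=> i; have li := regy_lt i.
  have [|n2 c2] := k2 (placey i).
    by apply: xout; rewrite placeyE; lia.
  rewrite ffunE; apply: (clean_emulates eyb eyo); first exact: c2.
  rewrite n2 st1 placeyE /moved /= s1k s10; last by lia.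
  have -> : (regy i == base) = false by lia.
  have -> : (regy i == regx (tm_in Mx)) = false by lia.
  have -> : (regy i == 2) = false by lia.
  by rewrite /= /regy eqn_add2l val_eqE (inj_eq enum_rank_inj).
have yout (j' : tape) : ~~ (offy <= j' < base) -> forall i, placey i != j'.
  move=> H i; apply: contra H => /eqP <-; rewrite placeyE; exact: regy_lt.
(* From here on no tape has to be clean: the leftovers of both machines are simply read as register
   values, among them the two outputs. *)
pose s3 r := content_nat one (T3 (inord r)).
have [s4 [e4 v4 k4]] := @code_ofP m O t2 [:: 2; regx (tm_out Mx); regy (tm_out My)]
  base s3 ltac:(lia) ltac:(by move=> r; rewrite !inE => /or3P[] /eqP ->; lia).
have E2 : exec O prog2 s3 _ := ESeq e4 (ESeq (exec_clear O 3 s4)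
  (@exec_move_reg m O base 3 _ ltac:(lia))).
have [|i|T4 [r4 st4 _]] := compile_sound one_neq_blank E2 _ (T := T3).
- exact: leq_trans prog2_tapes (leqW (leqnSn _)).
- by rewrite /s3 inord_val.
have Et : runs blank one O machine_core T0 T4.
  by apply: runs_seq r1 _; apply: runs_seq r2 _; apply: runs_seq r3 _.
have := @machine_of_outputs m sym tapes blank one one_neq_blank (inord 2) (inord 3)
  machine_core O j T4 Et.
rewrite st4 /moved /upd inordK //; last by lia.
set v := (X in tm_outputs _ _ _ X -> _).
suff -> : v = eval O t2 [:: j; cx; cy] by [].
rewrite {}/v /=.
rewrite v4 /=; congr (eval O t2 [:: _; _; _]).
- rewrite /s3; have [|-> _] := k3 (inord 2).
    by apply: yout; rewrite inordK //; lia.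
  have [|-> _] := k2 (inord 2).
    by apply: xout; rewrite inordK //; lia.
  rewrite st1 inordK; last by lia.
  rewrite /moved /=.
  by rewrite s10 //; lia.
- rewrite /s3; have [|-> _] := k3 (placex (tm_out Mx)); last by rewrite o2.
  by apply: yout; rewrite placexE; lia.
- by rewrite -oy -o3.
Qed.

End Assembly.

(** * Bounded search and sequence codes *)

Section Search.
Local Open Scope nat_scope.

(** A loop of known length that climbs while [P] holds at the next number and then stays put. For a
    downward closed [P] with [P 0] this is the largest solution up to [n]. *)
Definition search (n : nat) (P : pred nat) : nat :=
  iteri n (fun _ a => if P a.+1 then a.+1 else a) 0.

Lemma searchP n (P : pred nat) (a := search n P) :
  P 0 -> [/\ P a, a <= n & a < n -> ~~ P a.+1].
Proof.
rewrite {}/a /search => P0; elim: n => //= n; set a := iteri _ _ _ => -[Pa an aP].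
have [Pa1|Pa1] := ifPn; last by split=> //; exact: leqW.
split=> // lt_an; suff: ~~ P a.+1 by rewrite Pa1.
by apply: aP.
Qed.

Definition isqrt (n : nat) : nat := search n (fun a => a ^ 2 <= n).

Lemma isqrtP n : isqrt n ^ 2 <= n < (isqrt n).+1 ^ 2.
Proof.
have [|-> an aP] := @searchP n (fun a => a ^ 2 <= n) => //=.
rewrite -/(isqrt n) in an aP *; have [/aP|na] := ltnP (isqrt n) n; first by rewrite ltnNge.
by rewrite (leq_trans _ (leq_pexp2l _ (leqnSn 1))).
Qed.

Lemma divn_search n d : n %/ d.+1 = search n (fun a => a * d.+1 <= n).
Proof.
have [|Pa an aP] := @searchP n (fun a => a * d.+1 <= n) => //=.
set a := search _ _ in Pa an aP *.
apply/eqP; rewrite eqn_leq leq_divRL // Pa andbT -ltnS ltn_divLR //.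
have [/aP|na] := ltnP a n; first by rewrite ltnNge.
by rewrite (leq_ltn_trans na) // mulSn; nia.
Qed.

(* [CodeSeq.code (x :: s)] is [2 ^ x * (2 * CodeSeq.code s + 1)]. *)
Definition code_head (c : nat) : nat := search c (fun a => 2 ^ a %| c).
Definition code_tail (c : nat) : nat := c %/ 2 ^ (code_head c).+1.

Lemma decode_cons c : 0 < c ->
  CodeSeq.decode c = code_head c :: CodeSeq.decode (code_tail c).
Proof.
move=> c0; rewrite -[RHS]CodeSeq.codeK /= CodeSeq.decodeK; congr CodeSeq.decode.
have [|Pa an aP] := @searchP c (fun a => 2 ^ a %| c); first exact: dvd1n.
rewrite /code_tail -/(code_head c) in Pa an aP *; set a := code_head c in Pa an aP *.
have /aP : a < c.
  by rewrite ltn_neqAle an andbT; apply: contraTneq Pa => ->; rewrite gtnNdvd // ltn_expl.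
case/dvdnP: Pa => q ->; rewrite expnSr divnMA mulnK ?expn_gt0 // => H.
have qo : odd q.
  by apply: contraNT H; rewrite -dvdn2 [q * _]mulnC dvdn_pmul2l ?expn_gt0.
by rewrite mulnC divn2 -[in LHS](odd_double_half q) qo.
Qed.

(** Past the end of the list both sides are 0: the tails have reached 0, which [code_tail] and
    [code_head] map to 0. *)
Lemma nth_decode c i : nth 0 (CodeSeq.decode c) i = code_head (iter i code_tail c).
Proof.
elim: i c => [|i IH] c.
  by case: c => [|c] //; rewrite decode_cons.
rewrite iterSr -IH; case: c => [|c]; last by rewrite decode_cons.
by rewrite /code_tail div0n /= nth_nil.
Qed.

End Search.

(** * Closure properties of the functions primitive recursive in oracles *)

Section Definable.
Local Open Scope nat_scope.
Variable m : nat.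
Local Notation oracles := (m.-tuple (nat -> nat)).

(** The term stays hidden, so that programs are written as ordinary functions and compiled by
    closure lemmas alone. *)
Definition definable (f : oracles -> seq nat -> nat) : Prop :=
  exists t : term m, forall O s, eval O t s = f O s.

Lemma def_ext f g : (forall O s, f O s = g O s) -> definable f -> definable g.
Proof. by move=> fg [t tP]; exists t => O s; rewrite tP. Qed.

Lemma def_var i : definable (fun _ s => nth 0 s i).
Proof. by exists (TVar m i). Qed.

Lemma def_S f : definable f -> definable (fun O s => (f O s).+1).
Proof. by move=> [t tP]; exists (TSucc t) => O s /=; rewrite tP. Qed.

Lemma def_const k : definable (fun _ _ => k).
Proof. by elim: k => [|k /def_S //]; exists (TZero m). Qed.

Lemma def_oracle i f : definable f -> definable (fun O s => tnth O i (f O s)).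
Proof. by move=> [t tP]; exists (TOracle i t) => O s /=; rewrite tP. Qed.

Lemma def_let f a : definable f -> definable a ->
  definable (fun O s => f O (a O s :: s)).
Proof. by move=> [t tP] [u uP]; exists (TLet u t) => O s /=; rewrite tP uP. Qed.

Lemma def_shift f : definable f -> definable (fun O s => f O (behead s)).
Proof. by move=> [t tP]; exists (TShift t) => O s /=; rewrite tP. Qed.

Lemma def_iter k a g : definable k -> definable a -> definable g ->
  definable (fun O s => iteri (k O s) (fun i acc => g O [:: i, acc & s]) (a O s)).
Proof.
move=> [t tP] [u uP] [v vP]; exists (TIter t u v) => O s /=; rewrite tP uP.
by apply: eq_iteri => i acc; rewrite vP.
Qed.

Lemma def_comp h : definable (fun _ s => h (nth 0 s 0)) ->
  forall a, definable a -> definable (fun O s => h (a O s)).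
Proof. by move=> dh a da; apply: def_let dh da. Qed.

Lemma def_comp2 h : definable (fun _ s => h (nth 0 s 0) (nth 0 s 1)) ->
  forall a b, definable a -> definable b -> definable (fun O s => h (a O s) (b O s)).
Proof.
move=> dh a b da db.
exact: def_let (def_let dh (def_shift da)) db.
Qed.

Lemma def_add a b : definable a -> definable b -> definable (fun O s => a O s + b O s).
Proof.
apply: (def_comp2 (h := addn)).
apply: def_ext (def_iter (def_var 1) (def_var 0) (def_S (def_var 1))) => O s /=.
by rewrite addnC; elim: (nth 0 s 1) => //= k ->.
Qed.

Lemma def_mul a b : definable a -> definable b -> definable (fun O s => a O s * b O s).
Proof.
apply: (def_comp2 (h := muln)).
apply: def_ext (def_iter (def_var 0) (def_const 0) (def_add (def_var 1) (def_var 3))) => O s /=.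
by elim: (nth 0 s 0) => //= k ->; rewrite mulSn addnC.
Qed.

Lemma def_pred a : definable a -> definable (fun O s => (a O s).-1).
Proof.
apply: (def_comp (h := predn)).
apply: def_ext (def_iter (def_var 0) (def_const 0) (def_var 0)) => O s /=.
by case: (nth 0 s 0).
Qed.

Lemma def_sub a b : definable a -> definable b -> definable (fun O s => a O s - b O s).
Proof.
apply: (def_comp2 (h := subn)).
apply: def_ext (def_iter (def_var 1) (def_var 0) (def_pred (def_var 1))) => O s /=.
by elim: (nth 0 s 1) => [|k /= ->]; rewrite ?subn0 ?subnS.
Qed.

Lemma def_leq a b : definable a -> definable b ->
  definable (fun O s => (a O s <= b O s : nat)).
Proof.
move=> da db; apply: def_ext (def_sub (def_const 1) (def_sub da db)) => O s.
by rewrite /leq; case: (a O s - b O s) => // k; rewrite subSS sub0n.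
Qed.

Lemma def_if (c : oracles -> seq nat -> bool) a b :
  definable (fun O s => nat_of_bool (c O s)) -> definable a -> definable b ->
  definable (fun O s => if c O s then a O s else b O s).
Proof.
move=> dc da db; apply: def_ext
  (def_add (def_mul dc da) (def_mul (def_sub (def_const 1) dc) db)) => O s.
by case: (c O s); rewrite ?mul1n ?addn0.
Qed.

Lemma def_iterate k a h : definable k -> definable a ->
  definable (fun _ s => h (nth 0 s 0)) ->
  definable (fun O s => iter (k O s) h (a O s)).
Proof.
move=> dk da dh; apply: def_ext (def_iter dk da (def_shift dh)) => O s.
by elim: (k O s) => //= n ->; rewrite nth0.
Qed.

(** [P] receives the variable list as an argument because inside the loop the outer variables sit
    behind the loop index and the accumulator. *)
Lemma def_search (P : oracles -> seq nat -> pred nat) k :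
  (forall x, definable x ->
    definable (fun O s => nat_of_bool (P O (behead (behead s)) (x O s)))) ->
  definable k -> definable (fun O s => search (k O s) (P O s)).
Proof.
move=> dP dk.
pose g (O : oracles) s :=
  if P O (behead (behead s)) (nth 0 s 1).+1 then (nth 0 s 1).+1 else nth 0 s 1.
apply: (@def_ext (fun O s => iteri (k O s) (fun i acc => g O [:: i, acc & s]) 0)) => //.
have d1 := def_S (def_var 1).
by apply: def_iter => //; [exact: def_const|apply: def_if => //; [exact: dP|exact: def_var]].
Qed.

Lemma def_expn2 a : definable a -> definable (fun O s => 2 ^ a O s).
Proof.
apply: (def_comp (h := expn 2)).
apply: def_ext (def_iter (def_var 0) (def_const 1) (def_add (def_var 1) (def_var 1))) => O s /=.
by elim: (nth 0 s 0) => //= k ->; rewrite expnS mul2n addnn.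
Qed.

Lemma def_div a b : definable a -> definable b ->
  definable (fun O s => a O s %/ (b O s).+1).
Proof.
move=> da db; apply: (@def_ext (fun O s =>
  search (a O s) (fun t => t * (b O s).+1 <= a O s))).
  by move=> O s; rewrite divn_search.
apply: (@def_search (fun O s t => t * (b O s).+1 <= a O s)) (da) => x dx.
have da2 := def_shift (def_shift da); have db2 := def_shift (def_shift db).
exact: def_leq (def_mul dx (def_S db2)) da2.
Qed.

Lemma def_isqrt a : definable a -> definable (fun O s => isqrt (a O s)).
Proof.
move=> da; apply: (@def_search (fun O s t => t ^ 2 <= a O s)) (da) => x dx.
exact: def_leq (def_mul dx dx) (def_shift (def_shift da)).
Qed.

Lemma def_code_head a : definable a -> definable (fun O s => code_head (a O s)).
Proof.
move=> da; apply: (@def_search (fun O s t => 2 ^ t %| a O s)) (da) => x dx.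
have da2 := def_shift (def_shift da); have dx2 := def_expn2 dx.
have dq := def_div da2 (def_pred dx2).
apply: def_ext (def_leq da2 (def_mul dq dx2)) => O s.
rewrite prednK ?expn_gt0 //; congr nat_of_bool.
by rewrite dvdn_eq eqn_leq leq_divM.
Qed.

Lemma def_code_tail a : definable a -> definable (fun O s => code_tail (a O s)).
Proof.
move=> da; apply: def_ext (def_div da
  (def_pred (def_expn2 (def_S (def_code_head da))))) => O s.
by rewrite prednK ?expn_gt0.
Qed.

Lemma def_nth_decode a i : definable a -> definable i ->
  definable (fun O s => nth 0 (CodeSeq.decode (a O s)) (i O s)).
Proof.
move=> da di; apply: def_ext (def_code_head
  (def_iterate di da (def_code_tail (def_var 0)))) => O s.
by rewrite nth_decode.
Qed.

Lemma def_code_nil : definable (fun _ _ => CodeSeq.code [::]).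
Proof. exact: def_const. Qed.

Lemma def_code_cons a (l : oracles -> seq nat -> seq nat) :
  definable a -> definable (fun O s => CodeSeq.code (l O s)) ->
  definable (fun O s => CodeSeq.code (a O s :: l O s)).
Proof.
move=> da dl; apply: def_mul; first exact: def_expn2.
by apply: def_ext (def_S (def_add dl dl)) => O s; rewrite addnn.
Qed.

Lemma def_code (T : Type) (l : seq T) (F : T -> oracles -> seq nat -> nat) :
  (forall x, definable (F x)) ->
  definable (fun O s => CodeSeq.code [seq F x O s | x <- l]).
Proof.
by move=> dF; elim: l => [|x l IH] /=; [exact: def_code_nil|exact: def_code_cons].
Qed.

End Definable.

(** * Rational arithmetic on codes *)

Section DefinableRat.
Variable m : nat.
Local Notation oracles := (m.-tuple (nat -> nat)).
Local Notation definable := (@definable m).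

(** Any code of the value will do; fractions are therefore never reduced. *)
Definition definableQ (f : oracles -> seq nat -> rat) : Prop :=
  exists2 g, definable g & forall O s, nuQ (g O s) = f O s.

Lemma defQ_ext f g : (forall O s, f O s = g O s) -> definableQ f -> definableQ g.
Proof. by move=> fg [h dh hP]; exists h => // O s; rewrite hP. Qed.

Lemma defQ_nu g : definable g -> definableQ (fun O s => nuQ (g O s)).
Proof. by exists g. Qed.

Lemma defQ_frac i j k : definable i -> definable j -> definable k ->
  definableQ (fun O s => ((i O s)%:R - (j O s)%:R) / (k O s).+1%:R).
Proof.
move=> di dj dk; exists (fun O s => CodeSeq.code [:: i O s; j O s; k O s]).
  by do 3!(apply: def_code_cons => //); exact: def_code_nil.
by move=> O s; rewrite /nuQ CodeSeq.codeK.
Qed.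

Lemma defQ_inv_frac f : definableQ f -> exists i j k,
  [/\ definable i, definable j, definable k &
    forall O s, f O s = ((i O s)%:R - (j O s)%:R) / (k O s).+1%:R].
Proof.
move=> [g dg gP]; exists (fun O s => nth 0%N (CodeSeq.decode (g O s)) 0),
  (fun O s => nth 0%N (CodeSeq.decode (g O s)) 1),
  (fun O s => nth 0%N (CodeSeq.decode (g O s)) 2).
by split; try (apply: def_nth_decode => //; exact: def_const); move=> O s; rewrite -gP.
Qed.

Lemma defQ_const q : definableQ (fun _ _ => q).
Proof. by have [c cE] := nuQ_surj q; exists (fun _ _ => c); first exact: def_const. Qed.

Lemma defQ_nat f : definable f -> definableQ (fun O s => (f O s)%:R).
Proof.
move=> df; apply: defQ_ext (defQ_frac df (def_const m 0) (def_const m 0)) => O s.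
by rewrite subr0 divr1.
Qed.

Let fracD (i j i' j' : rat) (k k' : nat) :
  (i - j) / k.+1%:R + (i' - j') / k'.+1%:R =
  ((i * k'.+1%:R + i' * k.+1%:R) - (j * k'.+1%:R + j' * k.+1%:R)) / (k.+1 * k'.+1)%:R.
Proof. by rewrite natrM; field; rewrite !nat1r !pnatr_eq0. Qed.

Lemma defQ_add f g : definableQ f -> definableQ g ->
  definableQ (fun O s => f O s + g O s).
Proof.
move=> /defQ_inv_frac[i [j [k [di dj dk fE]]]] /defQ_inv_frac[i' [j' [k' [di' dj' dk' gE]]]].
have dK := def_S dk; have dK' := def_S dk'.
apply: defQ_ext (defQ_frac (def_add (def_mul di dK') (def_mul di' dK))
  (def_add (def_mul dj dK') (def_mul dj' dK)) (def_pred (def_mul dK dK'))) => O s.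
by rewrite fE gE fracD prednK ?muln_gt0 // !natrD !natrM.
Qed.

Lemma defQ_opp f : definableQ f -> definableQ (fun O s => - f O s).
Proof.
move=> /defQ_inv_frac[i [j [k [di dj dk fE]]]].
by apply: defQ_ext (defQ_frac dj di dk) => O s; rewrite fE -mulNr opprB.
Qed.

Lemma defQ_sub f g : definableQ f -> definableQ g ->
  definableQ (fun O s => f O s - g O s).
Proof. by move=> df /defQ_opp; apply: defQ_add. Qed.

Lemma defQ_mul f g : definableQ f -> definableQ g ->
  definableQ (fun O s => f O s * g O s).
Proof.
move=> /defQ_inv_frac[i [j [k [di dj dk fE]]]] /defQ_inv_frac[i' [j' [k' [di' dj' dk' gE]]]].
have dK := def_S dk; have dK' := def_S dk'.
apply: defQ_ext (defQ_frac (def_add (def_mul di di') (def_mul dj dj'))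
  (def_add (def_mul di dj') (def_mul dj di')) (def_pred (def_mul dK dK'))) => O s.
rewrite fE gE prednK ?muln_gt0 // !natrD !natrM.
by field; rewrite !nat1r !pnatr_eq0.
Qed.

Lemma defQ_sum (T : Type) (l : seq T) (F : T -> oracles -> seq nat -> rat) :
  (forall x, definableQ (F x)) -> definableQ (fun O s => \sum_(x <- l) F x O s).
Proof.
move=> dF; elim: l => [|x l IH].
  by apply: defQ_ext (defQ_const 0) => O s; rewrite big_nil.
by apply: defQ_ext (defQ_add (dF x) IH) => O s; rewrite big_cons.
Qed.

Let frac_ge0 (i j k : nat) : (0 <= (i%:R - j%:R) / k.+1%:R :> rat) = (j <= i)%N.
Proof. by rewrite pmulr_lge0 ?invr_gt0 ?ltr0n // subr_ge0 ler_nat. Qed.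

Lemma def_leQ f g : definableQ f -> definableQ g ->
  definable (fun O s => nat_of_bool (f O s <= g O s)).
Proof.
move=> df dg; have /defQ_inv_frac[i [j [k [di dj dk E]]]] := defQ_sub dg df.
by apply: def_ext (def_leq dj di) => O s; rewrite -subr_ge0 E frac_ge0.
Qed.

Lemma defQ_if (c : oracles -> seq nat -> bool) f g :
  definable (fun O s => nat_of_bool (c O s)) -> definableQ f -> definableQ g ->
  definableQ (fun O s => if c O s then f O s else g O s).
Proof.
move=> dc [a da aE] [b db bE]; exists (fun O s => if c O s then a O s else b O s).
  exact: def_if.
by move=> O s; case: (c O s).
Qed.

Lemma defQ_max f g : definableQ f -> definableQ g ->
  definableQ (fun O s => Num.max (f O s) (g O s)).
Proof.
move=> df dg; apply: defQ_ext (defQ_if (def_leQ dg df) df dg) => O s.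
by rewrite maxElt; case: ltP.
Qed.

(** For a positive value [(i - j) / (k + 1)] the truncated subtraction of [j] from [i] is exact, and
    numerator and denominator can be swapped in the code. *)
Lemma defQ_inv f : (forall O s, 0 < f O s) -> definableQ f ->
  definableQ (fun O s => (f O s)^-1).
Proof.
move=> f0 /defQ_inv_frac[i [j [k [di dj dk fE]]]].
apply: defQ_ext (defQ_frac (def_S dk) (def_const m 0) (def_pred (def_sub di dj))) => O s.
have := f0 O s; rewrite fE pmulr_lgt0 ?invr_gt0 ?ltr0n // subr_gt0 ltr_nat => ji.
by rewrite prednK ?subn_gt0 // invf_div subr0 natrB // ltnW.
Qed.

Lemma def_trunc f : definableQ f -> definable (fun O s => Num.truncn (f O s)).
Proof.
move=> /defQ_inv_frac[i [j [k [di dj dk fE]]]].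
apply: def_ext (def_div (def_sub di dj) dk) => O s; rewrite fE.
have [ij|ji] := leqP (j O s) (i O s).
  apply/esym/truncn_def; rewrite -natrB // ler_pdivlMr ?ltr0n // ltr_pdivrMr ?ltr0n //.
  by rewrite -!natrM ler_nat ltr_nat leq_divM ltn_ceil.
rewrite truncn_floor frac_ge0 leqNgt ji /=.
by have /eqP -> : (i O s - j O s == 0)%N; rewrite ?div0n // subn_eq0 ltnW.
Qed.

(** The square root of [q] cut off after [K] binary places. Truncating [4 ^ K * q] before taking the
    root is harmless: an integer square is at most a number iff it is at most its floor. *)
Definition qsqrt (K : nat) (q : rat) : rat :=
  (isqrt (Num.truncn (q * (2 ^ K * 2 ^ K)%:R)))%:R / (2 ^ K)%:R.

Lemma qsqrtP K q : 0 <= q ->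
  0 <= qsqrt K q /\ qsqrt K q ^+ 2 <= q < (qsqrt K q + 2 ^- K) ^+ 2.
Proof.
move=> q0; rewrite /qsqrt; set a := isqrt _.
have K0 : 0 < (2 ^ K)%:R :> rat by rewrite ltr0n expn_gt0.
have qK : 0 <= q * (2 ^ K * 2 ^ K)%:R by rewrite mulr_ge0.
have /andP[a1 a2] := isqrtP (Num.truncn (q * (2 ^ K * 2 ^ K)%:R)).
have /andP[t1 t2] := truncn_itv qK.
split; first by rewrite divr_ge0.
rewrite -natrX -[X in _ + X]mul1r -mulrDl natr1 !expr_div_n ler_pdivrMr ?ltr_pdivlMr ?exprn_gt0 //.
have -> : (2 ^ K)%:R ^+ 2 = (2 ^ K * 2 ^ K)%:R :> rat by rewrite natrM expr2.
rewrite -!natrX; apply/andP; split.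
  by apply: le_trans t1; rewrite ler_nat.
by apply: lt_le_trans t2 _; rewrite ler_nat.
Qed.

Lemma defQ_sqrt K f : definable K -> definableQ f ->
  definableQ (fun O s => qsqrt (K O s) (f O s)).
Proof.
move=> dK df; have d2 := def_expn2 dK.
have dt := def_isqrt (def_trunc (defQ_mul df (defQ_nat (def_mul d2 d2)))).
apply: defQ_ext (defQ_frac dt (def_const m 0) (def_pred d2)) => O s.
by rewrite /qsqrt subr0 prednK ?expn_gt0.
Qed.

Variable n : nat.

Definition definableV (f : oracles -> seq nat -> 'rV[rat]_n) : Prop :=
  exists2 g, definable g & forall O s, nuQn n (g O s) = f O s.

Lemma defV_ext f g : (forall O s, f O s = g O s) -> definableV f -> definableV g.
Proof. by move=> fg [h dh hP]; exists h => // O s; rewrite hP. Qed.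

Lemma defV_shift f : definableV f -> definableV (fun O s => f O (behead s)).
Proof.
by move=> [g dg gP]; exists (fun O s => g O (behead s)); first exact: def_shift.
Qed.

Lemma defV_nu g : definable g -> definableV (fun O s => nuQn n (g O s)).
Proof. by exists g. Qed.

Lemma defV_row (F : 'I_n -> oracles -> seq nat -> rat) :
  (forall i, definableQ (F i)) -> definableV (fun O s => \row_i F i O s).
Proof.
move=> dF; have /choice[g gP] : forall i, exists g,
    definable g /\ forall O s, nuQ (g O s) = F i O s.
  by move=> i; have [g ? ?] := dF i; exists g.
exists (fun O s => CodeSeq.code [seq g i O s | i <- enum 'I_n]).
  by apply: def_code => i; have [] := gP i.
move=> O s; apply/rowP => i; rewrite !mxE CodeSeq.codeK (nth_map i) ?size_enum_ord //.
by rewrite nth_ord_enum; have [_ ->] := gP i.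
Qed.

Lemma defQ_coord f i : definableV f -> definableQ (fun O s => f O s 0 i).
Proof.
move=> [g dg gP]; exists (fun O s => nth 0%N (CodeSeq.decode (g O s)) i).
  by apply: def_nth_decode => //; apply: def_const.
by move=> O s; rewrite -gP mxE.
Qed.

Lemma defV_add f g : definableV f -> definableV g ->
  definableV (fun O s => f O s + g O s).
Proof.
move=> df dg; apply: defV_ext (defV_row (F := fun i O s => f O s 0 i + g O s 0 i) _).
  by move=> O s; apply/rowP => i; rewrite !mxE.
by move=> i; apply: defQ_add; apply: defQ_coord.
Qed.

Lemma defV_scale c f : definableQ c -> definableV f ->
  definableV (fun O s => c O s *: f O s).
Proof.
move=> dc df; apply: defV_ext (defV_row (F := fun i O s => c O s * f O s 0 i) _).
  by move=> O s; apply/rowP => i; rewrite !mxE.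
by move=> i; apply: defQ_mul => //; apply: defQ_coord.
Qed.

Lemma defV_iter (step : oracles -> seq nat -> nat -> 'rV[rat]_n -> 'rV[rat]_n) k a :
  definable k -> definableV a ->
  (forall i g, definable i -> definable g ->
    definableV (fun O s => step O (behead (behead s)) (i O s) (nuQn n (g O s)))) ->
  definableV (fun O s => iteri (k O s) (step O s) (a O s)).
Proof.
move=> dk [b db bE] /(_ _ _ (def_var m 0) (def_var m 1))[g dg gE].
exists (fun O s => iteri (k O s) (fun i acc => g O [:: i, acc & s]) (b O s)).
  exact: def_iter.
by move=> O s; elim: (k O s) => [|N IH]; rewrite /= ?bE // gE /= IH.
Qed.

End DefinableRat.
(** * The pursuit equation *)

Section Euclid.
Variables (R : realType) (n : nat).
Implicit Types x y z : 'rV[R]_n.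

Definition dot x y : R := \sum_(i < n) x 0 i * y 0 i.

Lemma dotC x y : dot x y = dot y x.
Proof. by apply: eq_bigr => i _; rewrite mulrC. Qed.

Lemma dotDl x y z : dot (x + y) z = dot x z + dot y z.
Proof. by rewrite -big_split; apply: eq_bigr => i _; rewrite mxE mulrDl. Qed.

Lemma dotZl a x y : dot (a *: x) y = a * dot x y.
Proof. by rewrite big_distrr; apply: eq_bigr => i _; rewrite mxE /= mulrA. Qed.

Lemma dotDr x y z : dot x (y + z) = dot x y + dot x z.
Proof. by rewrite dotC dotDl !(dotC x). Qed.

Lemma dotZr a x y : dot x (a *: y) = a * dot x y.
Proof. by rewrite dotC dotZl dotC. Qed.

Lemma dotNl x y : dot (- x) y = - dot x y.
Proof. by rewrite -scaleN1r dotZl mulN1r. Qed.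

Lemma dotNr x y : dot x (- y) = - dot x y.
Proof. by rewrite dotC dotNl dotC. Qed.

Definition dotE := (dotDl, dotDr, dotNl, dotNr, dotZl, dotZr).

Lemma dot_ge0 x : 0 <= dot x x.
Proof. by apply: sumr_ge0 => i _; rewrite -expr2 sqr_ge0. Qed.

Lemma enorm_ge0 x : 0 <= enorm x.
Proof. exact: sqrtr_ge0. Qed.

Lemma sqr_enorm x : enorm x ^+ 2 = dot x x.
Proof.
rewrite sqr_sqrtr; last by apply: sumr_ge0 => i _; exact: sqr_ge0.
by apply: eq_bigr => i _; rewrite expr2.
Qed.

Lemma enorm_le a x : 0 <= a -> (enorm x <= a) = (dot x x <= a ^+ 2).
Proof. by move=> a0; rewrite -sqr_enorm ler_sqr ?nnegrE ?enorm_ge0. Qed.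

Lemma coord_le_enorm x i : `|x 0 i| <= enorm x.
Proof.
rewrite -ler_sqr ?nnegrE ?enorm_ge0 // sqr_enorm real_normK ?num_real //.
rewrite /dot (bigD1 i) //= -expr2 lerDl; apply: sumr_ge0 => j _.
by rewrite -expr2 sqr_ge0.
Qed.

Lemma enorm0 : enorm (0 : 'rV[R]_n) = 0.
Proof. by apply/eqP; rewrite -sqrf_eq0 sqr_enorm /dot big1 // => i _; rewrite mxE mul0r. Qed.

Lemma enorm_eq0 x : enorm x = 0 -> x = 0.
Proof.
move=> x0; apply/rowP => i; rewrite mxE; apply/eqP; rewrite -normr_le0 -x0.
exact: coord_le_enorm.
Qed.

Lemma enormZ a x : enorm (a *: x) = `|a| * enorm x.
Proof.
apply/eqP; rewrite -(eqrXn2 (ltn0Sn 1)) ?mulr_ge0 ?enorm_ge0 //.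
by rewrite exprMn !sqr_enorm !dotE real_normK ?num_real // mulrA expr2.
Qed.

Lemma enormN x : enorm (- x) = enorm x.
Proof. by rewrite -scaleN1r enormZ normrN1 mul1r. Qed.

Lemma enormC x y : enorm (x - y) = enorm (y - x).
Proof. by rewrite -enormN opprB. Qed.

Lemma dot_le x y : dot x y <= enorm x * enorm y.
Proof.
have [x0|x0] := eqVneq (enorm x) 0.
  by rewrite x0 mul0r (enorm_eq0 x0) -(scale0r 0) dotZl mul0r.
have [y0|y0] := eqVneq (enorm y) 0.
  by rewrite y0 mulr0 (enorm_eq0 y0) -(scale0r 0) dotZr mul0r.
have xy0 : 0 < 2 * (enorm x * enorm y).
  by rewrite mulr_gt0 ?mulr_gt0 // lt_def enorm_ge0 ?x0 ?y0.
(* Cauchy-Schwarz: this square expands to [2 |x| |y| (|x| |y| - x.y)]. *)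
have := dot_ge0 (enorm y *: x - enorm x *: y).
rewrite !dotE (dotC y x) -!sqr_enorm => H; rewrite -subr_ge0 -(pmulr_rge0 _ xy0).
by apply: le_trans H _; rewrite le_eqVlt; apply/orP; left; apply/eqP; ring.
Qed.

Lemma dot_ge x y : - (enorm x * enorm y) <= dot x y.
Proof. by rewrite lerNl -dotNl -(enormN x); exact: dot_le. Qed.

Lemma enormD x y : enorm (x + y) <= enorm x + enorm y.
Proof.
rewrite enorm_le ?addr_ge0 ?enorm_ge0 // !dotE (dotC y x) sqrrD !sqr_enorm.
by have := dot_le x y; lra.
Qed.

Lemma enormB x y : enorm (x - y) <= enorm x + enorm y.
Proof. by rewrite -(enormN y); exact: enormD. Qed.

Lemma enorm_dist y x z : enorm (x - z) <= enorm (x - y) + enorm (y - z).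
Proof. by rewrite -[x - z](subrKA y); exact: enormD. Qed.

Lemma ler_enormB x y : `|enorm x - enorm y| <= enorm (x - y).
Proof.
rewrite ler_norml; apply/andP; split.
  by have := enormD (y - x) x; rewrite subrK enormC; lra.
by have := enormD (x - y) y; rewrite subrK; lra.
Qed.

Lemma enorm_le_sum x : enorm x <= \sum_i `|x 0 i|.
Proof.
rewrite enorm_le ?sumr_ge0 // expr2 big_distrl /=; apply: ler_sum => i _.
apply: le_trans (ler_norm _) _; rewrite normrM ler_wpM2l // (bigD1 i) //= lerDl.
by rewrite sumr_ge0.
Qed.

End Euclid.

Section Pursuit.
Variables (R : realType) (n : nat) (e : R).
Hypothesis e_gt0 : 0 < e.
Implicit Types x y z : 'rV[R]_n.

Definition chase z : 'rV[R]_n := (Num.max (enorm z) e)^-1 *: z.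

Let max_gt0 z : 0 < Num.max (enorm z) e.
Proof. by rewrite lt_max e_gt0 orbT. Qed.

Lemma chase_le1 z : enorm (chase z) <= 1.
Proof.
rewrite enormZ ger0_norm ?invr_ge0 ?(ltW (max_gt0 z)) // mulrC ler_pdivrMr // mul1r.
by rewrite le_max lexx.
Qed.

Lemma dist_max (a b c : R) : `|Num.max a c - Num.max b c| <= `|a - b|.
Proof.
have h1 := ler_norm (a - b); have := ler_norm (b - a); rewrite distrC => h2.
rewrite ler_norml !maxEle.
by have [?|?] := leP a c; have [?|?] := leP b c; apply/andP; split; lra.
Qed.

(** [1/r - 1/s = (s - r) / (r s)]; the factor [1/s] absorbs [|z|], and [1/r] is at most [1/e]. Only
    [s] has to dominate [|z|], so that [r] may come from a rounded norm. *)
Lemma scale_inv_dist z r s : e <= r -> e <= s -> enorm z <= s ->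
  enorm (r^-1 *: z - s^-1 *: z) <= e^-1 * `|r - s|.
Proof.
move=> er es zs; have r0 : 0 < r by exact: lt_le_trans er.
have s0 : 0 < s by exact: lt_le_trans es.
rewrite -scalerBl enormZ.
have -> : r^-1 - s^-1 = r^-1 * s^-1 * (s - r) by field; rewrite ?gt_eqF.
rewrite normrM (distrC s) ger0_norm ?mulr_ge0 ?invr_ge0 ?(ltW r0) ?(ltW s0) //.
rewrite mulrAC ler_wpM2r // -mulrA; apply: (@le_trans _ _ (r^-1 * 1)).
  by rewrite ler_wpM2l ?invr_ge0 ?(ltW r0) // mulrC ler_pdivrMr // mul1r.
by rewrite mulr1 lef_pV2.
Qed.

(** [chase e] is [1/e] times the projection onto the ball of radius [e], so [1/e] would be sharp;
    the detour through [p^-1 *: y] changes vector and factor separately and costs [1/e] each. *)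
Lemma chase_lip x y : enorm (chase x - chase y) <= 2 / e * enorm (x - y).
Proof.
set p := (Num.max (enorm x) e); set q := (Num.max (enorm y) e).
have pE : chase x = p^-1 *: x by []. have qE : chase y = q^-1 *: y by [].
have ep : e <= p by rewrite le_max lexx orbT.
have eq : e <= q by rewrite le_max lexx orbT.
have p0 : 0 < p by exact: lt_le_trans ep.
have := enorm_dist (p^-1 *: y) (chase x) (chase y).
have : enorm (p^-1 *: y - chase y) <= e^-1 * `|p - q|.
  by rewrite qE; apply: scale_inv_dist => //; rewrite le_max lexx.
have : enorm (chase x - p^-1 *: y) <= e^-1 * enorm (x - y).
  rewrite pE -scalerBr enormZ ger0_norm ?invr_ge0 ?(ltW p0) //.
  by rewrite ler_wpM2r ?enorm_ge0 ?lef_pV2.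
have : `|p - q| <= enorm (x - y).
  apply: le_trans (ler_enormB x y).
  exact: dist_max.
rewrite -(ler_pM2l (x := e^-1)) ?invr_gt0 //; lra.
Qed.

Lemma chase_far z : e <= enorm z -> enorm (chase z) = 1 /\ dot z (chase z) = enorm z.
Proof.
move=> ez; rewrite /chase (max_idPl ez); have z0 : 0 < enorm z by exact: lt_le_trans ez.
rewrite enormZ dotZr -sqr_enorm expr2 mulKf ?gt_eqF // ger0_norm ?invr_ge0 ?(ltW z0) //.
by rewrite mulVf ?gt_eqF.
Qed.

End Pursuit.

(** * Displacement under a control *)

Section Position.
Variables (R : realType) (n : nat).
Local Notation mu := (@lebesgue_measure R).
Implicit Types (w : R -> 'rV[R]_n).

Lemma control_integrable w t (i : 'I_n) : control w ->
  mu.-integrable `[0, t] (EFin \o (fun r => w r 0 i)).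
Proof.
move=> [mw w1]; apply: measurable_bounded_integrable => //.
- by rewrite /= lebesgue_measure_itv /=; case: ifP => _; rewrite -?EFinB ltry.
- apply: measurable_funS (mw i) => //.
  by apply: subset_itvl; rewrite bnd_simp.
- exists 1; split=> // M M1 r /=; rewrite in_itv /= => /andP[r0 _].
  by apply: le_trans (ltW M1); apply: le_trans (coord_le_enorm _ _) (w1 r r0).
Qed.

Lemma EFin_integrableD (D : set R) f g : measurable D ->
  mu.-integrable D (EFin \o f) -> mu.-integrable D (EFin \o g) ->
  mu.-integrable D (EFin \o (fun r => f r + g r)).
Proof.
move=> mD intf intg; have -> : EFin \o (fun r => f r + g r) =
  ((EFin \o f) \+ (EFin \o g))%E by apply/funext.
exact: integrableD.
Qed.

Lemma EFin_integrableZl (D : set R) a f : measurable D ->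
  mu.-integrable D (EFin \o f) -> mu.-integrable D (EFin \o (fun r => a * f r)).
Proof.
move=> mD intf; have -> : EFin \o (fun r => a * f r) =
  (fun r => a%:E * (EFin \o f) r)%E by apply/funext.
exact: integrableZl.
Qed.

Lemma Rintegral_sum (I : Type) (l : seq I) (D : set R) (f : I -> R -> R) :
  measurable D -> (forall i, mu.-integrable D (EFin \o f i)) ->
  mu.-integrable D (EFin \o (fun r => \sum_(i <- l) f i r)) /\
  \int[mu]_(r in D) (\sum_(i <- l) f i r) = \sum_(i <- l) \int[mu]_(r in D) f i r.
Proof.
move=> mD intf; elim: l => [|i l [IH1 IH2]].
  have -> : (fun r => \sum_(j <- [::]) f j r) = fun=> 0.
    by apply/funext => r; rewrite big_nil.
  by rewrite big_nil Rintegral_cst // mul0r; split=> //; exact: integrable0.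
have E : (fun r => \sum_(j <- i :: l) f j r) = (fun r => f i r + \sum_(j <- l) f j r).
  by apply/funext => r; rewrite big_cons.
rewrite E big_cons -IH2 RintegralD //; split=> //.
exact: EFin_integrableD.
Qed.

(* Pairing the integral with itself turns the vector bound into a scalar one. *)
Lemma position_dist w z c B s t : control w -> 0 <= s <= t ->
  (forall r, s <= r <= t -> enorm (w r - c) <= B) ->
  enorm (position z w t - position z w s - (t - s) *: c) <= B * (t - s).
Proof.
move=> cw /andP[s0 st] wB; set I := _ - _ - _.
have B0 : 0 <= B by apply: le_trans (enorm_ge0 _) (wB s _); rewrite lexx.
pose D := `]s, t]%classic : set R.
have mD : measurable D by exact: measurable_itv.
have muD : fine (mu D) = t - s.
  rewrite /= lebesgue_measure_itv /= lte_fin; case: ltP => //= ts.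
  by apply/esym/eqP; rewrite subr_eq0 eq_le ts.
have Dfin : (mu D < +oo)%E.
  by rewrite /= lebesgue_measure_itv /=; case: ifP => _; rewrite -?EFinB ltry.
have intw i : mu.-integrable D (EFin \o (fun r => w r 0 i)).
  apply: integrableS (control_integrable t i cw) => //.
  move=> r /=; rewrite !in_itv /= => /andP[sr rt]; apply/andP; split=> //.
  exact: le_trans s0 (ltW sr).
have intc (a : R) : mu.-integrable D (EFin \o (fun=> a)).
  apply: measurable_bounded_integrable => //; exists `|a|.
  by split=> // M M1 r _ /=; rewrite ltW.
have intwc i : mu.-integrable D (EFin \o (fun r => w r 0 i - c 0 i)).
  exact: EFin_integrableD mD (intw i) (intc _).
have IE i : I 0 i = \int[mu]_(r in D) (w r 0 i - c 0 i).
  rewrite RintegralB // Rintegral_cst // muD -(Rintegral_itvB (a := BLeft 0)) ?bnd_simp //.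
    by rewrite !mxE; ring.
  exact: control_integrable.
have [intS sumS] := Rintegral_sum (enum 'I_n) (f := fun i r => I 0 i * (w r 0 i - c 0 i))
  mD (fun i => EFin_integrableZl (I 0 i) mD (intwc i)).
have : dot I I <= enorm I * B * (t - s).
  have -> : dot I I = \int[mu]_(r in D) (\sum_(i <- enum 'I_n) I 0 i * (w r 0 i - c 0 i)).
    rewrite sumS /dot big_enum /=; apply: eq_bigr => i _.
    by rewrite RintegralZl // IE.
  rewrite -muD -Rintegral_cst //.
  apply: le_Rintegral; [exact: mD|exact: intS|exact: intc|move=> r /=].
  rewrite /D /= in_itv /= => /andP[sr rt]; rewrite big_enum /=.
  apply: le_trans (_ : enorm I * enorm (w r - c) <= _); last first.
    by rewrite ler_wpM2l ?enorm_ge0 // wB // ltW.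
  apply: le_trans (dot_le _ _); rewrite le_eqVlt; apply/orP; left; apply/eqP.
  by apply: eq_bigr => i _; rewrite !mxE.
have [->|I0] := eqVneq (enorm I) 0; first by rewrite mulr_ge0 // subr_ge0.
rewrite -sqr_enorm expr2 -mulrA ler_pM2l // lt_def I0.
exact: enorm_ge0.
Qed.

Lemma position_lip w z s t : control w -> 0 <= s <= t ->
  enorm (position z w t - position z w s) <= t - s.
Proof.
move=> cw /andP[s0 st].
have := @position_dist w z 0 1 s t cw _ _; rewrite s0 st scaler0 subr0 mul1r; apply=> // r.
by move=> /andP[sr _]; rewrite subr0; apply: cw.2; exact: le_trans sr.
Qed.

Lemma position0 w z : position z w 0 = z.
Proof.
rewrite /position; apply/rowP => i; rewrite !mxE.
by rewrite (_ : `[0, 0]%classic = [set 0 : R]) ?Rintegral_set1 ?addr0 // set_itv1.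
Qed.

End Position.

(** * Dyadic limits and the discrete Gronwall inequality *)

Section Limits.
Variable R : realType.

Lemma pow2_gt0 m : 0 < 2 ^- m :> R.
Proof. by rewrite invr_gt0 exprn_gt0. Qed.

Lemma pow2_le1 m : 2 ^- m <= 1 :> R.
Proof. by rewrite invf_le1 ?exprn_gt0 // exprn_ege1 // ler1n. Qed.

Lemma pow2S m : 2 ^- m = 2 * 2 ^- m.+1 :> R.
Proof. by rewrite exprS invfM mulrA divff ?mul1r // pnatr_eq0. Qed.

Lemma pow2_small (a : R) : 0 < a -> exists m, 2 ^- m < a.
Proof.
move=> a0; exists (Num.truncn a^-1).+1; rewrite invf_plt ?posrE ?exprn_gt0 //.
apply: lt_trans (truncnS_gt _) _; rewrite -natrX ltr_nat.
by apply: ltn_expl.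
Qed.

(** Inequalities pass to the limit this way: they are proved on the grid of step [2 ^- m] up to an
    error [C * 2 ^- m], where [C] may depend on everything but [m]. *)
Lemma le_of_pow2 (a b C : R) : (forall m, a <= b + C * 2 ^- m) -> a <= b.
Proof.
move=> H; rewrite leNgt; apply/negP => ba.
have C0 : 0 < `|C| + 1 by rewrite ltr_wpDl.
have [|m mP] := @pow2_small ((a - b) / (`|C| + 1)); first by rewrite divr_gt0 ?subr_gt0.
rewrite ltr_pdivlMr // in mP; have := H m; have := ler_norm C.
have := pow2_gt0 m; nra.
Qed.

(* [u m - 2 C 2^-m] increases, [u m + 2 C 2^-m] decreases. *)
Lemma geometric_limit (u : nat -> R) C :
  (forall m, `|u m.+1 - u m| <= C * 2 ^- m) ->
  exists l, forall m, `|l - u m| <= 2 * C * 2 ^- m.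
Proof.
move=> uC; pose a m := u m - 2 * C * 2 ^- m; pose b m := u m + 2 * C * 2 ^- m.
have C0 : 0 <= C by have := uC 0%N; rewrite expr0 invr1 mulr1; apply: le_trans.
have aS m : a m <= a m.+1.
  by have := uC m; rewrite ler_norml /a pow2S => /andP[+ _]; lra.
have bS m : b m.+1 <= b m.
  by have := uC m; rewrite ler_norml /b pow2S => /andP[_ +]; lra.
have ab m k : a m <= b k.
  have ah i : a i <= b i by rewrite /a /b; have := pow2_gt0 i; nra.
  have am i : a m <= a (m + i)%N.
    by elim: i => [|i IH]; rewrite ?addn0 // addnS (le_trans IH).
  have bm i : b (k + i)%N <= b k.
    by elim: i => [|i IH]; rewrite ?addn0 // addnS (le_trans _ IH).
  by apply: le_trans (am k) _; rewrite addnC; apply: le_trans (ah _) (bm m).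
exists (sup (range a)) => m.
have aub k : ubound (range a) (b k) by move=> _ [i _ <-].
have : a m <= sup (range a).
  by apply: ub_le_sup; [exists (b 0%N)|exists m].
have : sup (range a) <= b m by apply: ge_sup; [exists (a 0%N), 0%N|].
by rewrite ler_norml /a /b; lra.
Qed.

Lemma pow_1D_le_expR (a : R) k : 0 <= a -> (1 + a) ^+ k <= expR (k%:R * a).
Proof.
move=> a0; rewrite mulrC expRM_natr lerXn2r ?nnegrE ?expR_ge0 ?addr_ge0 //.
exact: expR_ge1Dx.
Qed.

End Limits.

Section Gronwall.
Variables (R : realType) (n : nat).

(** Both sequences may violate the recursion because three comparisons are needed: two sampled
    trajectories, two Euler schemes, and a rounded scheme with a sampled trajectory. The growth
    factor multiplies the whole sum of errors, which keeps the bound a simple product. *)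
Lemma gronwall (G : nat -> 'rV[R]_n -> 'rV[R]_n) (L h d1 d2 : R)
    (xi eta : nat -> 'rV[R]_n) (N : nat) :
  0 <= L -> 0 <= h -> 0 <= d1 -> 0 <= d2 ->
  (forall k x x', enorm (G k x - G k x') <= L * enorm (x - x')) ->
  (forall k, (k < N)%N -> enorm (xi k.+1 - xi k - h *: G k (xi k)) <= h * d1) ->
  (forall k, (k < N)%N -> enorm (eta k.+1 - eta k - h *: G k (eta k)) <= h * d2) ->
  forall k, (k <= N)%N ->
  enorm (xi k - eta k) <=
    (1 + L * h) ^+ k * (enorm (xi 0%N - eta 0%N) + k%:R * h * (d1 + d2)).
Proof.
move=> L0 h0 d10 d20 GL xiP etaP; elim=> [|k IH] kN.
  by rewrite expr0 mul1r !mul0r addr0.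
have {IH} := IH (ltnW kN); set A := (1 + L * h) ^+ k => IH.
have {xiP} := xiP k kN; set p := xi k.+1 - _ - _ => pP.
have {etaP} := etaP k kN; set q := eta k.+1 - _ - _ => qP.
have gP := GL k (xi k) (eta k); set g := G k _ - G k _ in gP.
have -> : xi k.+1 - eta k.+1 = p - q + (xi k - eta k) + h *: g.
  by rewrite /p /q /g; apply/rowP => i; rewrite !mxE; ring.
have A1 : 1 <= A by rewrite exprn_ege1 // lerDl mulr_ge0.
apply: le_trans (enormD _ _) _; apply: le_trans (lerD (enormD _ _) (lexx _)) _.
apply: le_trans (lerD (lerD (enormB _ _) (lexx _)) (lexx _)) _.
rewrite enormZ ger0_norm // exprS -/A.
have hg : h * enorm g <= h * (L * enorm (xi k - eta k)) by rewrite ler_wpM2l.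
apply: le_trans (lerD (lerD (lerD pP qP) (lexx _)) hg) _.
have H1 : (1 + L * h) * enorm (xi k - eta k) <=
   (1 + L * h) * (A * (enorm (xi 0%N - eta 0%N) + k%:R * h * (d1 + d2))).
  by rewrite ler_wpM2l // addr_ge0 // mulr_ge0.
have H2 : h * (d1 + d2) <= (1 + L * h) * A * (h * (d1 + d2)).
  rewrite ler_peMl ?mulr_ge0 ?addr_ge0 //; apply: (le_trans A1).
  by apply: ler_peMl; [exact: le_trans ler01 A1|rewrite lerDl mulr_ge0].
rewrite -natr1; move: H1 H2; lra.
Qed.

End Gronwall.

(** * Trajectories and their uniqueness *)

Section Dynamics.
Variables (R : realType) (n : nat) (e : R).
Hypothesis e_gt0 : 0 < e.
Local Notation L := (2 / e).
Local Notation ch := (chase e).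
Implicit Types (x y : R -> 'rV[R]_n).

Definition slow y := forall s t, 0 <= s <= t -> enorm (y t - y s) <= t - s.

(* A first-order form of x' = chase (y - x) that avoids derivatives. *)
Definition pursues y x := slow x /\ forall t h, 0 <= t -> 0 <= h ->
  enorm (x (t + h) - x t - h *: ch (y t - x t)) <= 2 * L * h ^+ 2.

Let L_ge0 : 0 <= L. Proof. by rewrite divr_ge0 // ltW. Qed.

Lemma chase_sub_lip (p z z' : 'rV[R]_n) :
  enorm (ch (p - z) - ch (p - z')) <= L * enorm (z - z').
Proof.
apply: le_trans (chase_lip e_gt0 _ _) _.
by rewrite ler_wpM2l // opprB addrC subrKA enormC.
Qed.

Lemma pursues_unique y x x' t : pursues y x -> pursues y x' -> x 0 = x' 0 ->
  0 <= t -> x t = x' t.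
Proof.
move=> [_ px] [_ px'] x00 t0; apply/eqP; rewrite -subr_eq0; apply/eqP/enorm_eq0/eqP.
rewrite eq_le enorm_ge0 andbT.
apply: (@le_of_pow2 _ _ _ (expR (L * t) * (t * (4 * L * t)))) => m; rewrite add0r.
(* [2 ^ m] steps of this length end exactly at [t], and the defects [2 * L * h] of both trajectories
   vanish with [h]. *)
pose h := t * 2 ^- m.
have h0 : 0 <= h by rewrite mulr_ge0 ?(ltW (pow2_gt0 _ _)).
have hm : (2 ^ m)%:R * h = t.
  by rewrite /h mulrCA natrX divff ?mulr1 // expf_neq0 // pnatr_eq0.
have step z : (forall s h, 0 <= s -> 0 <= h ->
      enorm (z (s + h) - z s - h *: ch (y s - z s)) <= 2 * L * h ^+ 2) ->
    forall k, enorm (z (k.+1%:R * h) - z (k%:R * h) - h *: ch (y (k%:R * h) - z (k%:R * h)))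
    <= h * (2 * L * h).
  move=> pz k; have := pz (k%:R * h) h (mulr_ge0 (ler0n _ _) h0) h0.
  have -> : k.+1%:R * h = k%:R * h + h by rewrite -natr1; ring.
  by move=> H; apply: le_trans H _; lra.
have d0 : 0 <= 2 * L * h := mulr_ge0 (mulr_ge0 (ler0n _ 2) L_ge0) h0.
have := @gronwall R n (fun k z => ch (y (k%:R * h) - z)) L h (2 * L * h) (2 * L * h)
  (fun k => x (k%:R * h)) (fun k => x' (k%:R * h)) (2 ^ m) L_ge0 h0 d0 d0
  (fun k => chase_sub_lip (y (k%:R * h))) (fun k _ => step x px k)
  (fun k _ => step x' px' k) (2 ^ m)%N (leqnn _).
rewrite hm mul0r x00 subrr enorm0 add0r => H; apply: le_trans H _.
apply: (@le_trans _ _ (expR (L * t) * (t * (2 * L * h + 2 * L * h)))).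
  rewrite ler_wpM2r ?mulr_ge0 ?(addr_ge0 d0 d0) //.
  by apply: le_trans (pow_1D_le_expR _ (mulr_ge0 L_ge0 h0)) _; rewrite mulrCA hm.
by rewrite /h; lra.
Qed.

Definition chaser : strategy R n := fun p q _ => ch (q - p).

Lemma trajectory_pursues (x0 y0 : 'rV[R]_n) v x (y := position y0 v) :
  control v -> trajectory x0 y0 chaser v x ->
  pursues y x /\ x 0 = x0.
Proof.
pose w s := ch (y s - x s); rewrite /trajectory /chaser /= -/y -/w => cv [cw xE].
have sx : slow x.
  move=> s t st; have /andP[s0 s_t] := st.
  by rewrite !xE ?(le_trans s0) //; apply: position_lip.
split; last by rewrite xE ?lexx // position0.
split=> // t h t0 h0; rewrite -/(w t) (xE _ (addr_ge0 t0 h0)) (xE t t0).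
have -> : h *: w t = (t + h - t) *: w t by congr (_ *: _); ring.
have -> : 2 * L * h ^+ 2 = 2 * L * h * (t + h - t) by ring.
apply: position_dist => //; first by rewrite t0 lerDl.
move=> r /andP[tr rth]; apply: le_trans (chase_lip e_gt0 _ _) _.
(* Each player moves by at most [h] during the step, so [y - x] changes by at most [2 * h]; hence
   the constant in [pursues]. *)
have -> : 2 * L * h = L * (2 * h) by ring.
rewrite ler_wpM2l //.
have -> : y r - x r - (y t - x t) = y r - y t - (x r - x t).
  by apply/rowP => i; rewrite !mxE; ring.
apply: le_trans (enormB _ _) _.
have := sx t r; rewrite t0 tr => /(_ isT).
have := @position_lip R n v y0 t r cv; rewrite t0 tr => /(_ isT); rewrite -/y; lra.
Qed.

End Dynamics.

(** * Convergence of Euler's method *)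

Section EulerLimit.
Variables (R : realType) (n : nat) (e : R).
Hypothesis e_gt0 : 0 < e.
Local Notation L := (2 / e).
Local Notation ch := (chase e).
Variables (y : R -> 'rV[R]_n) (x0 : 'rV[R]_n).
Hypothesis slow_y : slow y.

Fixpoint euler (m k : nat) : 'rV[R]_n :=
  if k is k'.+1 then
    euler m k' + 2 ^- m *: ch (y (k'%:R * 2 ^- m) - euler m k')
  else x0.

Let L_ge0 : 0 <= L. Proof. by rewrite divr_ge0 // ltW. Qed.
Let d_gt0 m : 0 < 2 ^- m :> R. Proof. exact: pow2_gt0. Qed.
Let d_ge0 m : 0 <= 2 ^- m :> R. Proof. exact: ltW. Qed.

Lemma euler_slow m k j : enorm (euler m (k + j) - euler m k) <= j%:R * 2 ^- m.
Proof.
elim: j => [|j IH]; first by rewrite addn0 subrr enorm0 mul0r.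
rewrite addnS /= -[j.+1%:R]natr1 mulrDl mul1r addrAC; apply: le_trans (enormD _ _) _.
rewrite lerD // enormZ ger0_norm // -[leRHS]mulr1 ler_wpM2l //.
exact: chase_le1.
Qed.

(** The discrete form of the estimate in [pursues]. For [j = 2] it measures how far two fine steps
    are from one coarse step; for many steps it survives in the limit and yields [pursues]
    itself. *)
Lemma euler_segment m k j :
  enorm (euler m (k + j) - euler m k
         - (j%:R * 2 ^- m) *: ch (y (k%:R * 2 ^- m) - euler m k))
    <= L * (j%:R * 2 ^- m) ^+ 2.
Proof.
set c := ch _; elim: j => [|j IH].
  by rewrite addn0 subrr mul0r scale0r subr0 enorm0 expr0n mulr0.
pose t : R := (k + j)%:R * 2 ^- m.
have -> : euler m (k + j.+1) - euler m k - (j.+1%:R * 2 ^- m) *: c =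
   (euler m (k + j) - euler m k - (j%:R * 2 ^- m) *: c)
   + 2 ^- m *: (ch (y t - euler m (k + j)) - c).
  by rewrite addnS /= -/t -[j.+1%:R]natr1; apply/rowP => i; rewrite !mxE; ring.
apply: le_trans (enormD _ _) _; apply: le_trans (lerD IH (lexx _)) _.
rewrite enormZ ger0_norm //.
have : enorm (ch (y t - euler m (k + j)) - c) <= L * (2 * (j%:R * 2 ^- m)).
  apply: le_trans (chase_lip e_gt0 _ _) _; rewrite ler_wpM2l //.
  have -> : y t - euler m (k + j) - (y (k%:R * 2 ^- m) - euler m k) =
    y t - y (k%:R * 2 ^- m) - (euler m (k + j) - euler m k).
    by apply/rowP => i; rewrite !mxE; ring.
  apply: le_trans (enormB _ _) _; rewrite mulr2n mulrDl mul1r lerD ?euler_slow //.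
  apply: le_trans (slow_y _) _.
    by rewrite mulr_ge0 //= ler_wpM2r // ler_nat leq_addr.
  by rewrite /t natrD mulrDl addrC addKr.
rewrite -(ler_pM2l (d_gt0 m)) => H; apply: le_trans (lerD (lexx _) H) _.
rewrite -[j.+1%:R]natr1; have := mulr_ge0 L_ge0 (mulr_ge0 (d_ge0 m) (d_ge0 m)); nra.
Qed.

(* Two half steps differ from a full step of length [h] by at most [L h^2]. *)
Lemma euler_refine m k :
  enorm (euler m.+1 k.*2 - euler m k) <=
    expR (L * (k%:R * 2 ^- m)) * (k%:R * 2 ^- m * L) * 2 ^- m.
Proof.
pose G j z := ch (y (j%:R * 2 ^- m) - z).
have Ld0 : 0 <= L * 2 ^- m by exact: mulr_ge0.
have double j : j%:R * 2 ^- m = j.*2%:R * 2 ^- m.+1 :> R.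
  by rewrite (pow2S _ m) -mul2n natrM; ring.
have fine j : (j < k)%N ->
    enorm (euler m.+1 j.+1.*2 - euler m.+1 j.*2 - 2 ^- m *: G j (euler m.+1 j.*2))
      <= 2 ^- m * (L * 2 ^- m).
  have := euler_segment m.+1 j.*2 2; rewrite -double -pow2S addn2 -doubleS => H _.
  by apply: le_trans H _; rewrite expr2 mulrCA.
have coarse j : (j < k)%N ->
    enorm (euler m j.+1 - euler m j - 2 ^- m *: G j (euler m j)) <= 2 ^- m * 0.
  by rewrite /= addrAC addrK subrr enorm0 mulr0.
have := gronwall L_ge0 (d_ge0 m) Ld0 (lexx 0)
  (fun j => chase_sub_lip e_gt0 (y (j%:R * 2 ^- m))) fine coarse (leqnn k).
rewrite subrr enorm0 add0r addr0 => H; apply: le_trans H _.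
rewrite [leRHS](_ : _ = expR (L * (k%:R * 2 ^- m)) * (k%:R * 2 ^- m * (L * 2 ^- m)));
  last by ring.
rewrite ler_wpM2r ?(mulr_ge0 (mulr_ge0 (ler0n _ k) (d_ge0 m)) Ld0) //.
by apply: le_trans (pow_1D_le_expR _ Ld0) _; rewrite mulrCA.
Qed.

Definition euler_at (m : nat) (t : R) := euler m (Num.truncn (t * 2 ^+ m)).

Lemma trunc_pow2 m (t : R) (k := Num.truncn (t * 2 ^+ m)) : 0 <= t ->
  k%:R * 2 ^- m <= t < k%:R * 2 ^- m + 2 ^- m.
Proof.
move=> t0; have p0 : 0 < 2 ^+ m :> R by rewrite exprn_gt0.
have /truncn_itv/andP[] : 0 <= t * 2 ^+ m by rewrite mulr_ge0 // ltW.
rewrite -/k -ler_pdivrMr // -ltr_pdivlMr // => -> /lt_le_trans -> //.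
by rewrite -[k.+1%:R]natr1 mulrDl mul1r.
Qed.

Let rate t := expR (L * t) * (t * L) + 1.

Lemma euler_at_step m t : 0 <= t ->
  enorm (euler_at m.+1 t - euler_at m t) <= rate t * 2 ^- m.
Proof.
move=> t0; rewrite /euler_at.
have := trunc_pow2 m t0; have := trunc_pow2 m.+1 t0.
set k := Num.truncn (t * 2 ^+ m); set k' := Num.truncn _.
move=> /andP[k1' k2'] /andP[k1 k2]; have d0 := d_gt0 m.+1.
(* The finer grid index is [k.*2] or [k.*2.+1]; the possible extra half step is what the summand 1
   of [rate] pays for. *)
have lo : (k.*2 <= k')%N.
  rewrite -ltnS -(ltr_nat R) -[k'.+1%:R]natr1 -mul2n natrM -(ltr_pM2r d0).
  by move: (pow2S R m) k1 k2'; nra.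
have hi : (k' - k.*2 <= 1)%N.
  rewrite leq_subLR addn1 -ltnS -(ltr_nat R) -[k.*2.+2%:R]natr1 -[k.*2.+1%:R]natr1.
  by rewrite -mul2n natrM -(ltr_pM2r d0); move: (pow2S R m) k2 k1'; nra.
rewrite -(subnKC lo); apply: le_trans (enorm_dist (euler m.+1 k.*2) _ _) _.
rewrite /rate mulrDl mul1r addrC lerD //.
  apply: le_trans (euler_refine m k) _; rewrite ler_wpM2r // ler_pM //.
  - exact: mulr_ge0 (mulr_ge0 (ler0n _ _) (d_ge0 m)) L_ge0.
  - by rewrite ler_expR ler_wpM2l.
  - by rewrite ler_wpM2r.
apply: le_trans (euler_slow _ _ _) _; apply: (@le_trans _ _ (1 * 2 ^- m.+1)).
  by rewrite ler_wpM2r // -[1]/(1%:R) ler_nat.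
by rewrite (pow2S R m); have := d_ge0 m.+1; lra.
Qed.

Lemma euler_limit : exists x : R -> 'rV[R]_n, exists2 C : R -> R,
  (forall t, 0 <= C t) &
  forall t m, 0 <= t -> enorm (x t - euler_at m t) <= C t * 2 ^- m.
Proof.
have /choice[x xP] : forall t, exists z : 'rV[R]_n, 0 <= t -> forall m,
    enorm (z - euler_at m t) <= n%:R * (2 * rate t) * 2 ^- m.
  move=> t; have [t0|_] := leP 0 t; last by exists 0.
  have /choice[f fP] : forall i, exists l : R, forall m,
      `|l - euler_at m t 0 i| <= 2 * rate t * 2 ^- m.
    move=> i; apply: (geometric_limit (u := fun m => euler_at m t 0 i)) => m.
    apply: le_trans (euler_at_step m t0).
    by have := coord_le_enorm (euler_at m.+1 t - euler_at m t) i; rewrite !mxE.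
  exists (\row_i f i) => _ m; apply: le_trans (enorm_le_sum _) _.
  apply: (@le_trans _ _ (\sum_(i < n) 2 * rate t * 2 ^- m)).
    by apply: ler_sum => i _; have := fP i m; rewrite !mxE.
  by rewrite sumr_const card_ord -[leLHS]mulr_natl mulrA.
(* The factor [n] comes from summing the errors of the coordinates; the absolute value keeps the
   constant nonnegative at negative times. *)
exists x, (fun t => n%:R * (2 * rate `|t|)) => [t|t m t0].
  rewrite !mulr_ge0 // addr_ge0 // mulr_ge0 ?expR_ge0 //.
  exact: mulr_ge0 (normr_ge0 _) L_ge0.
by rewrite ger0_norm //; exact: xP.
Qed.

(** Invariance of [S] is stated together with existence because it is visible on the Euler points
    only; the trajectory inherits it from them since [S] is closed. *)
Lemma pursuit_exists : exists x, [/\ pursues e y x, x 0 = x0 &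
  forall S : set 'rV[R]_n, closed S -> @convex_set R 'rV[R]_n S -> S x0 ->
    stays_in S y -> stays_in S x].
Proof.
have [x [C C0 xC]] := euler_limit.
have slow_x : slow x.
  move=> s t /andP[s0 st]; have t0 := le_trans s0 st.
  apply: (@le_of_pow2 _ _ _ (C s + C t + 1)) => m.
  have := xC s m s0; have := xC t m t0; rewrite /euler_at.
  have := trunc_pow2 m t0; have := trunc_pow2 m s0.
  set k := Num.truncn (s * _); set k' := Num.truncn _.
  move=> /andP[k1 k2] /andP[k1' k2'].
  have kk' : (k <= k')%N.
    by apply: le_truncn; rewrite ler_wpM2r // exprn_ge0.
  rewrite -(subnKC kk') => xt xs.
  have := euler_slow m k (k' - k); have := xt; have := xs.
  have := enorm_dist (euler m (k + (k' - k))) (x t) (x s).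
  have := enorm_dist (euler m k) (euler m (k + (k' - k))) (x s).
  rewrite [enorm (euler m k - x s)]enormC.
  have : (k' - k)%:R * 2 ^- m <= t - s + 2 ^- m.
    by rewrite natrB // mulrBl; lra.
  lra.
exists x; split; first split=> //.
- move=> t h t0 h0; have th0 := addr_ge0 t0 h0.
  have tth : t <= t + h by rewrite lerDl.
  (* A bound for the coefficient of [2 ^- m] in the sum of all errors below: the end points, the
     rounding of [t] and [h] to the grid, the change of direction, and the excess length of the
     segment. *)
  pose B := C (t + h) + C t + 2 + h * (L * (1 + C t)) + L * (2 * h + 1).
  apply: (@le_trans _ _ (L * h ^+ 2)).
    apply: (@le_of_pow2 _ _ _ B) => m.
    have := xC t m t0; have := xC (t + h) m th0; rewrite /euler_at.
    have := trunc_pow2 m th0; have := trunc_pow2 m t0.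
    set k := Num.truncn (t * _); set k' := Num.truncn _.
    move=> /andP[k1 k2] /andP[k1' k2'].
    have kk' : (k <= k')%N.
      by apply: le_truncn; rewrite ler_wpM2r // exprn_ge0.
    rewrite -(subnKC kk'); set j := (k' - k)%N => xth xt.
    have jd : j%:R * 2 ^- m = k'%:R * 2 ^- m - k%:R * 2 ^- m :> R.
      by rewrite natrB // mulrBl.
    have jh : `|h - j%:R * 2 ^- m| <= 2 ^- m by rewrite jd ler_norml; lra.
    have yk : enorm (y t - y (k%:R * 2 ^- m)) <= 2 ^- m.
      apply: le_trans (slow_y _) _; last by lra.
      by rewrite k1 mulr_ge0.
    pose c := ch (y (k%:R * 2 ^- m) - euler m k).
    have seg := euler_segment m k j; rewrite -/c in seg.
    have c1 : enorm c <= 1 by exact: chase_le1.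
    have cc : enorm (c - ch (y t - x t)) <= L * ((1 + C t) * 2 ^- m).
      apply: le_trans (chase_lip e_gt0 _ _) _; rewrite ler_wpM2l //.
      have -> : y (k%:R * 2 ^- m) - euler m k - (y t - x t) =
        x t - euler m k - (y t - y (k%:R * 2 ^- m)).
        by apply/rowP => i; rewrite !mxE; ring.
      by apply: le_trans (enormB _ _) _; rewrite mulrDl mul1r addrC lerD.
    have -> : x (t + h) - x t - h *: ch (y t - x t) =
      (x (t + h) - euler m (k + j)) - (x t - euler m k)
      + (h *: (c - ch (y t - x t)) - (h - j%:R * 2 ^- m) *: c)
      + (euler m (k + j) - euler m k - (j%:R * 2 ^- m) *: c).
      by apply/rowP => i; rewrite !mxE; ring.
    apply: le_trans (enormD _ _) _; apply: le_trans (lerD (enormD _ _) seg) _.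
    apply: le_trans (lerD (lerD (enormB _ _) (enormB _ _)) (lexx _)) _.
    rewrite (enormZ h) (enormZ _ c) (ger0_norm h0).
    have hcc := ler_wpM2l h0 cc.
    have jc : `|h - j%:R * 2 ^- m| * enorm c <= 2 ^- m * 1.
      by apply: ler_pM => //; exact: enorm_ge0.
    have jj : L * (j%:R * 2 ^- m) ^+ 2 <= L * (h ^+ 2 + (2 * h + 1) * 2 ^- m).
      rewrite ler_wpM2l //; have j0 : 0 <= j%:R * 2 ^- m :> R by rewrite mulr_ge0.
      have := pow2_le1 R m; have := d_ge0 m; move: jh; rewrite ler_norml => /andP[+ +].
      set J := j%:R * _ in j0 *; set d := 2 ^- m; nra.
    apply: le_trans (lerD (lerD (lerD xth xt) (lerD hcc jc)) jj) _.
    by rewrite /B; have := d_ge0 m; lra.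
  by have := mulr_ge0 L_ge0 (sqr_ge0 h); lra.
- apply/eqP; rewrite -subr_eq0; apply/eqP/enorm_eq0/eqP.
  rewrite eq_le enorm_ge0 andbT; apply: (@le_of_pow2 _ _ _ (C 0)) => m.
  have := xC 0 m (lexx 0); rewrite /euler_at mul0r truncn0 add0r; exact.
move=> S clS cvS Sx0 Sy t t0.
have Seuler m k : 2 ^- m <= e -> S (euler m k).
  move=> me; elim: k => [|k IH] //=.
  set q := y _; have Sq : S q by apply: Sy; rewrite mulr_ge0.
  rewrite /chase; set M := Num.max _ _.
  have eM : e <= M by rewrite le_max lexx orbT.
  have M0 : 0 < M by exact: lt_le_trans eM.
  (* The Euler step covers the fraction [2 ^- m / M] of the way to [q], which is at most 1 once the
     step is at most [e]; this excludes coarse grids. *)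
  have l0 : 0 <= 2 ^- m / M by rewrite divr_ge0 // ltW.
  have l1 : 2 ^- m / M <= 1 by rewrite ler_pdivrMr // mul1r (le_trans me).
  have l01 : Itv.spec (@Itv.num_sem R) (Itv.Real `[0%Z, 1%Z]) (2 ^- m / M).
    by apply/andP; split; rewrite ?num_real //= in_itv /= l0 l1.
  have /set_mem := cvS q (euler m k) (Itv.mk l01) (mem_set Sq) (mem_set IH).
  rewrite /conv /= => H; suff <- : 2 ^- m / M *: q + (1 - 2 ^- m / M) *: euler m k =
    euler m k + 2 ^- m *: (M^-1 *: (q - euler m k)) by exact: H.
  by apply/rowP => i; rewrite !mxE; ring.
apply: clS => V /nbhs_ballP[r /= r0 rV].
have [m0 m0P] := pow2_small e_gt0.
have [|m1 m1P] := @pow2_small R (r / (C t + 1)); first by rewrite divr_gt0 // ltr_wpDl.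
(* [m0] keeps the Euler points in [S], [m1] brings them within [r] of [x t]. *)
pose m := (m0 + m1)%N.
have mono i j : 2 ^- (i + j) <= 2 ^- i :> R.
  by rewrite exprD invfM ler_piMr // pow2_le1.
exists (euler_at m t); split.
  by apply: Seuler; apply: le_trans (mono _ _) (ltW m0P).
apply: rV; split=> // i j; rewrite ord1 -ball_normE /=.
have := coord_le_enorm (x t - euler_at m t) j; rewrite !mxE => H.
apply: le_lt_trans H _; apply: le_lt_trans (xC t m t0) _.
have m1r : 2 ^- m1 * (C t + 1) < r by rewrite -ltr_pdivlMr // ltr_wpDl.
apply: le_lt_trans m1r; rewrite mulrC ler_pM //; last by rewrite lerDl.
by rewrite /m addnC mono.
Qed.

End EulerLimit.
(** * Capture *)

Section Capture.
Variables (R : realType) (n : nat) (e : R).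
Hypothesis e_gt0 : 0 < e.
Local Notation L := (2 / e).
Local Notation ch := (chase e).
Implicit Types x y : R -> 'rV[R]_n.

Let L_ge0 : 0 <= L. Proof. by rewrite divr_ge0 // ltW. Qed.

(** The bound is only known on [[0, +oo[]; freezing [f] before time 0 gives a Lipschitz, hence
    continuous, function on the whole line that agrees with it there. *)
Lemma measurable_lipschitz (f : R -> R) K :
  (forall s t, 0 <= s <= t -> `|f t - f s| <= K * (t - s)) ->
  measurable_fun (`[0, +oo[ : set R) f.
Proof.
move=> fK; pose g t := f (Num.max 0 t).
have K0 : 0 <= K.
  have := fK 0 1; rewrite lexx ler01 subr0 mulr1 => /(_ isT); exact: le_trans.
have gK s t : `|g t - g s| <= K * `|t - s|.
  wlog st : s t / s <= t => [H|].
    by have [/H//|/ltW/H] := leP s t; rewrite distrC [`|s - t|]distrC.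
  apply: (@le_trans _ _ (K * (Num.max 0 t - Num.max 0 s))).
    by apply: fK; rewrite le_max lexx /= ge_max !le_max lexx st orbT.
  rewrite ler_wpM2l // ger0_norm ?subr_ge0 // !maxEle.
  by have [?|?] := leP 0 s; have [?|?] := leP 0 t; lra.
have cg : continuous g.
  move=> t; apply/cvgrPdist_le => eps eps0.
  have K1 : 0 < K + 1 by rewrite ltr_wpDl.
  near=> s; apply: le_trans (gK s t) _.
  apply: (@le_trans _ _ ((K + 1) * `|t - s|)); first by rewrite ler_wpM2r // lerDl.
  rewrite mulrC -ler_pdivlMr //; near: s.
  by apply: cvgr_dist_le => //; rewrite divr_gt0.
apply: (@eq_measurable_fun _ _ _ _ _ g) => [t|].
  by rewrite inE /= in_itv /= andbT /g => t0; rewrite max_r.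
apply: measurable_funTS; exact: continuous_measurable_fun.
Unshelve. all: by end_near. Qed.

Lemma chase_variation y x s t : slow y -> slow x -> 0 <= s <= t ->
  enorm (ch (y t - x t) - ch (y s - x s)) <= L * (2 * (t - s)).
Proof.
move=> sy sx st; apply: le_trans (chase_lip e_gt0 _ _) _; rewrite ler_wpM2l //.
have -> : y t - x t - (y s - x s) = y t - y s - (x t - x s).
  by apply/rowP => i; rewrite !mxE; ring.
apply: le_trans (enormB _ _) _.
by have := sy s t st; have := sx s t st; lra.
Qed.

Lemma slow_position (y0 : 'rV[R]_n) v : control v -> slow (position y0 v).
Proof. by move=> cv s t; exact: position_lip. Qed.

(** The difference [G] of [x] and the integral of its velocity changes by [O(h^2)] over a step, as
    both have the same first-order term. Over [t / h] steps this adds up to [O(h)], so [G]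
    vanishes. *)
Lemma pursues_trajectory (x0 y0 : 'rV[R]_n) v x : control v ->
  pursues e (position y0 v) x -> x 0 = x0 ->
  trajectory x0 y0 (chaser e) v x.
Proof.
move=> cv [sx px] x00; set y := position y0 v in px.
have sy : slow y by exact: slow_position.
pose w s := ch (y s - x s).
have cw : control w.
  split=> [i|t _]; last exact: chase_le1.
  apply: (@measurable_lipschitz _ (2 * L)) => s t st.
  have := coord_le_enorm (w t - w s) i; rewrite !mxE => H; apply: le_trans H _.
  by apply: le_trans (chase_variation sy sx st) _; rewrite mulrCA mulrA.
split=> // t t0; rewrite /chaser -/y -/w.
pose G s := x s - position x0 w s.
have stepG s h : 0 <= s -> 0 <= h -> enorm (G (s + h) - G s) <= 4 * L * h ^+ 2.
  have sh : s + h - s = h by rewrite addrAC subrr add0r.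
  move=> s0 h0; have := px s h s0 h0; rewrite -/(w s).
  have := @position_dist R n w x0 (w s) (2 * L * h) s (s + h) cw.
  rewrite s0 lerDl h0 => /(_ isT) H H'.
  have -> : G (s + h) - G s = (x (s + h) - x s - h *: w s)
    - (position x0 w (s + h) - position x0 w s - (s + h - s) *: w s).
    rewrite sh /G.
    move: (x (s + h)) (x s) (position x0 w (s + h)) (position x0 w s) (h *: w s) => a b c d f.
    by apply/rowP => i; rewrite !mxE; ring.
  apply: le_trans (enormB _ _) _; apply: le_trans (lerD H' (H _)) _.
    move=> r /andP[sr rsh]; apply: le_trans (chase_variation sy sx _) _.
      by rewrite s0.
    by have := ler_wpM2l L_ge0 (_ : r - s <= h); rewrite lerBlDl => /(_ rsh); lra.
  by rewrite sh; lra.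
apply/eqP; rewrite -subr_eq0; apply/eqP/enorm_eq0/eqP; rewrite -/(G t).
rewrite eq_le enorm_ge0 andbT; apply: (@le_of_pow2 _ _ _ (4 * L * t ^+ 2)) => m.
rewrite add0r; pose h := t * 2 ^- m.
have h0 : 0 <= h by rewrite mulr_ge0 // ltW // pow2_gt0.
have hm : (2 ^ m)%:R * h = t.
  by rewrite /h mulrCA natrX divff ?mulr1 // expf_neq0 // pnatr_eq0.
have Gk k : enorm (G (k%:R * h)) <= k%:R * (4 * L * h ^+ 2).
  elim: k => [|k IH].
    by rewrite !mul0r /G x00 position0 subrr enorm0.
  have H := stepG (k%:R * h) h (mulr_ge0 (ler0n _ _) h0) h0.
  have := enormD (G (k%:R * h + h) - G (k%:R * h)) (G (k%:R * h)).
  rewrite subrK -[k.+1%:R]natr1 !(mulrDl k%:R) !mul1r => H'.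
  by apply: le_trans H' _; rewrite [leRHS]addrC lerD.
have := Gk (2 ^ m)%N; rewrite hm => H; apply: le_trans H _.
rewrite mulrCA expr2 [(2 ^ m)%:R * _]mulrA hm /h le_eqVlt; apply/orP; left; apply/eqP.
by ring.
Qed.

(** The derivative is replaced by an increment over a step of length [h], with displacements [dp] of
    Pursuer and [dq] of Evader. In the proof [q] and [a] play the roles of [h (v - w)] and [h (v.w)]
    of the overview, whose [w] is called [v] here. *)
Lemma lyapunov_step (D K rho h : R) (p z dp dq : 'rV[R]_n)
    (Psi := fun p z => dot p z - K / 2 * dot z z) :
  K = D ^+ 2 / e ^+ 2 -> 0 <= h -> enorm p <= D -> e <= enorm z <= 2 * D ->
  enorm dp <= h -> enorm dq <= h -> enorm (dp - h *: ch z) <= rho ->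
  h * e / 2 - ((3 + 2 * K) * D * rho + (2 + 2 * K) * h ^+ 2)
    <= Psi (p + dp) (z + (dq - dp)) - Psi p z.
Proof.
move=> KE h0 pD /andP[ez zD] dph dqh; set r := dp - _ => rP.
have D0 : 0 <= D by apply: le_trans (enorm_ge0 p) pD.
have K0 : 0 <= K by rewrite KE divr_ge0 ?sqr_ge0.
have [v1 zv] := chase_far e_gt0 ez; set v := ch z in v1 zv r rP.
set d := enorm z in ez zD zv.
have zE : z = d *: v.
  rewrite /v /chase (max_idPl ez) scalerA mulfV ?scale1r //.
  by rewrite gt_eqF // (lt_le_trans e_gt0).
clearbody v; pose q := dq - h *: v; pose a := dot dq v.
have dpE : dp = h *: v + r by rewrite /r addrC subrK.
have vv : dot v v = 1 by rewrite -sqr_enorm v1 expr1n.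
have f1 : dot dp z = h * d + dot r z.
  by rewrite dpE dotDl dotZl (dotC v) zv.
have f4 : dot z q = d * (a - h).
  by rewrite {1}zE /q !dotE vv (dotC v) -/a; ring.
have f7 : enorm q ^+ 2 <= 2 * h * (h - a).
  rewrite sqr_enorm /q !dotE vv (dotC v) -/a -sqr_enorm.
  by have := enorm_ge0 dq; nra.
(* This inequality fixes [K]: half of the gain [h * e] together with [K * e * (h - a)] has to
   outweigh [D * |q|], and [K * e = D ^ 2 / e] is what completing the square requires. The case
   [h = 0] is separate because one multiplies by [2 * h * e]. *)
have f8 : D * enorm q <= h * e / 2 + K * e * (h - a).
  have [h_eq|h_neq] := eqVneq h 0.
    have -> : enorm q = 0.
      apply/eqP; rewrite -sqrf_eq0 eq_le sqr_ge0 andbT.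
      by move: f7; rewrite h_eq mulr0 mul0r.
    have : a = 0.
      have dq0 : enorm dq = 0 by apply/eqP; rewrite eq_le enorm_ge0 andbT -h_eq.
      by rewrite /a (enorm_eq0 dq0) -(scale0r 0) dotZl mul0r.
    by rewrite h_eq => ->; rewrite !(mul0r, mulr0, subr0, addr0).
  have hp : 0 < h by rewrite lt_def h_neq.
  have Ke : K * e = D ^+ 2 / e by rewrite KE; field; rewrite gt_eqF.
  rewrite Ke -(ler_pM2l (_ : 0 < 2 * h * e)) ?mulr_gt0 //.
  have -> : 2 * h * e * (h * e / 2 + D ^+ 2 / e * (h - a)) =
     (h * e) ^+ 2 + D ^+ 2 * (2 * h * (h - a)) by field; rewrite gt_eqF.
  (* AM-GM: [2 (h e) (D |q|) <= (h e)^2 + (D |q|)^2] *)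
  have := ler_wpM2l (sqr_ge0 D) f7; have := sqr_ge0 (h * e - D * enorm q).
  by lra.
have f2 := dot_ge p q; have f2' := dot_le p r.
have f3 := dot_ge dp (dq - dp); have f5 := dot_le z r; have f5' := dot_ge r z.
have f5'' := dot_ge z r.
have dqp : enorm (dq - dp) <= 2 * h by apply: le_trans (enormB _ _) _; lra.
have rho0 : 0 <= rho by apply: le_trans (enorm_ge0 _) rP.
have g2 : enorm p * enorm q <= D * enorm q by rewrite ler_wpM2r ?enorm_ge0.
have g2' : enorm p * enorm r <= D * rho by rewrite ler_pM ?enorm_ge0.
have g3 : enorm dp * enorm (dq - dp) <= h * (2 * h) by rewrite ler_pM ?enorm_ge0.
have g5 : enorm z * enorm r <= 2 * D * rho by rewrite ler_pM ?enorm_ge0.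
have g6 : dot (dq - dp) (dq - dp) <= (2 * h) ^+ 2.
  by rewrite -sqr_enorm ler_sqr ?nnegrE ?enorm_ge0 // mulr_ge0.
have qr : dq - dp = q - r by rewrite /q dpE opprD addrA.
(* Exact expansion. Replacing [dp] by [h *: v] costs [(1 + 2 + 2 * K) * D * rho] in the three
   products with [r]; the quadratic terms cost [2 * h ^ 2] and [2 * K * h ^ 2]. *)
have -> : Psi (p + dp) (z + (dq - dp)) - Psi p z =
  dot dp z + dot p (dq - dp) + dot dp (dq - dp)
   - K * dot z (dq - dp) - K / 2 * dot (dq - dp) (dq - dp).
  rewrite /Psi; move: (dq - dp) => s.
  by rewrite !dotE (dotC s z); field.
have pqr : dot p (dq - dp) = dot p q - dot p r by rewrite qr dotDr dotNr.
have zqr : dot z (dq - dp) = d * (a - h) - dot z r by rewrite qr dotDr dotNr f4.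
rewrite pqr zqr f1.
have ah : 0 <= h - a.
  by have := dot_le dq v; rewrite v1 mulr1 -/a; lra.
have k1 : K * e * (h - a) <= K * d * (h - a).
  by rewrite ler_wpM2r // ler_wpM2l.
have k2 : K * dot z r >= - (K * (2 * D * rho)).
  by rewrite -mulrN ler_wpM2l //; lra.
have k3 : K / 2 * dot (dq - dp) (dq - dp) <= K / 2 * (2 * h) ^+ 2.
  by rewrite ler_wpM2l // divr_ge0.
have k4 : h * e <= h * d by rewrite ler_wpM2l.
have k5 : - (2 * D * rho) <= dot r z by move: f5' g5; rewrite (mulrC (enorm r)); lra.
lra.
Qed.

Lemma capture y x D : slow y -> pursues e y x ->
  (forall t, 0 <= t -> enorm (x t) <= D /\ enorm (y t) <= D) ->
  exists2 t, 0 <= t & enorm (x t - y t) <= e.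
Proof.
move=> sy [sx px] bD; apply: contrapT => far.
have {}far t : 0 <= t -> e < enorm (x t - y t).
  by move=> t0; rewrite ltNge; apply/negP => H; apply: far; exists t.
pose K := D ^+ 2 / e ^+ 2; pose Psi (p z : 'rV[R]_n) : R := dot p z - K / 2 * dot z z.
have D0 : 0 <= D by have [+ _] := bD 0 (lexx 0); apply: le_trans (enorm_ge0 _).
have K0 : 0 <= K by rewrite divr_ge0 ?sqr_ge0.
(* The second-order coefficient in [lyapunov_step] for [rho = 2 * L * h ^ 2]. *)
pose A := (3 + 2 * K) * D * (2 * L) + (2 + 2 * K).
have A0 : 0 < A.
  apply: ltr_wpDl; last by rewrite ltr_pwDl // mulr_ge0.
  by rewrite (mulr_ge0 (mulr_ge0 (addr_ge0 (ler0n _ 3) (mulr_ge0 (ler0n _ 2) K0)) D0)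
    (mulr_ge0 (ler0n _ 2) L_ge0)).
(* With this step [A * h ^ 2 = h * e / 4], so that half of the first-order gain [h * e / 2]
   survives. *)
pose h := e / (4 * A); have h0 : 0 < h by rewrite divr_gt0 // mulr_gt0.
pose z t := y t - x t.
have zD t : 0 <= t -> e <= enorm (z t) <= 2 * D.
  move=> t0; rewrite {1}enormC ltW ?far //=; apply: le_trans (enormB _ _) _.
  by have [] := bD t t0; lra.
have step k : Psi (x (k%:R * h)) (z (k%:R * h)) + h * e / 4 <=
   Psi (x (k.+1%:R * h)) (z (k.+1%:R * h)).
  set t := k%:R * h; have t0 : 0 <= t by rewrite mulr_ge0 // ltW.
  have -> : k.+1%:R * h = t + h by rewrite -natr1 mulrDl mul1r.
  have tth : 0 <= t <= t + h by rewrite t0 lerDl ltW.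
  have := @lyapunov_step D K (2 * L * h ^+ 2) h (x t) (z t)
    (x (t + h) - x t) (y (t + h) - y t) erefl (ltW h0) (bD t t0).1 (zD t t0) _ _
    (px t h t0 (ltW h0)).
  have sxh := sx _ _ tth; have syh := sy _ _ tth.
  have thE : t + h - t = h by rewrite addrAC subrr add0r.
  rewrite thE in sxh syh => /(_ sxh syh).
  have -> : x t + (x (t + h) - x t) = x (t + h) by rewrite addrC subrK.
  have -> : z t + (y (t + h) - y t - (x (t + h) - x t)) = z (t + h).
    by rewrite /z; apply/rowP => i; rewrite !mxE; ring.
  rewrite -/(Psi (x (t + h)) (z (t + h))) -/(Psi (x t) (z t)).
  have -> : (3 + 2 * K) * D * (2 * L * h ^+ 2) + (2 + 2 * K) * h ^+ 2 = A * h ^+ 2.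
    by rewrite /A; ring.
  have -> : A * h ^+ 2 = h * e / 4.
    by rewrite /h; field; rewrite !gt_eqF //.
  lra.
have grow k : Psi (x 0) (z 0) + k%:R * (h * e / 4) <= Psi (x (k%:R * h)) (z (k%:R * h)).
  elim: k => [|k IH]; first by rewrite !mul0r addr0.
  by apply: le_trans (step k); rewrite -[k.+1%:R]natr1 mulrDl mul1r addrA lerD2r.
have upper t : 0 <= t -> Psi (x t) (z t) <= D * (2 * D).
  move=> t0; have := dot_le (x t) (z t); have [/andP[_ z2] [x1 _]] := (zD t t0, bD t t0).
  have : enorm (x t) * enorm (z t) <= D * (2 * D) by rewrite ler_pM ?enorm_ge0.
  have : 0 <= K / 2 * dot (z t) (z t) by rewrite mulr_ge0 ?dot_ge0 // divr_ge0.
  by rewrite /Psi; lra.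
have he : 0 < h * e / 4 by apply: divr_gt0; [exact: mulr_gt0|rewrite ltr0n].
(* So many gains of [h * e / 4] lift [Psi] above its upper bound. *)
pose N := (Num.truncn ((D * (2 * D) - Psi (x 0) (z 0)) / (h * e / 4))).+1.
have : (D * (2 * D) - Psi (x 0) (z 0)) / (h * e / 4) < N%:R by exact: truncnS_gt.
rewrite ltr_pdivrMr //.
have := grow N; have := upper (N%:R * h) (mulr_ge0 (ler0n _ _) (ltW h0)); lra.
Qed.

End Capture.
(** * Computing the trajectory *)

Section Algorithm.
Variables (n : nat) (eps : rat) (Ln : nat).
Hypothesis eps_gt0 : 0 < eps.
Local Notation oracles := (3.-tuple (nat -> nat)).
Implicit Type O : oracles.

Definition time_oracle : 'I_3 := @Ordinal 3 0 isT.
Definition value_oracle : 'I_3 := @Ordinal 3 1 isT.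
Definition modulus_oracle : 'I_3 := @Ordinal 3 2 isT.

Definition time_approx O (k : nat) : rat :=
  nuQ (nth 0%N (CodeSeq.decode (tnth O time_oracle k)) 0).

(* The [4] leaves room for the errors of two approximations of the time. *)
Definition horizon O : nat := (Num.truncn (time_approx O 0) + 4)%N.

(* [4 ^ (Ln N)] bounds the Gronwall factor [exp (L N)], and [2 ^ c >= c] takes
   care of the polynomial factor [c] of the error. *)
Definition precision O (j : nat) : nat :=
  (j + (2 * (Ln * horizon O) + (3 + horizon O * Ln * (4 + 2 * horizon O))))%N.

(** Adding the exponents makes the step [2 ^- level] at most the target precision and at most the
    modulus of [v] for that precision up to the horizon. *)
Definition level O (j : nat) : nat :=
  (precision O j + tnth O modulus_oracle (CodeSeq.code [:: horizon O; precision O j]))%N.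

(** A time near 0 may have a negative approximation; [truncn] then gives 0 steps. *)
Definition nsteps O (j : nat) : nat :=
  Num.truncn (time_approx O (level O j) * (2 ^ level O j)%:R).

(** The inner code denotes [l / 2 ^ level], since [nuQ] adds one to the third entry. *)
Definition sample O (j l : nat) : 'rV[rat]_n :=
  nuQn n (tnth O value_oracle (CodeSeq.code
    [:: CodeSeq.code [:: l; 0; (2 ^ level O j).-1]; precision O j]))%N.

Definition evader_approx O (j : nat) (q0 : 'rV[rat]_n) (k : nat) : 'rV[rat]_n :=
  iteri k (fun l acc => acc + (2 ^ level O j)%:R^-1 *: sample O j l) q0.

Definition chase_approx (K : nat) (z : 'rV[rat]_n) : 'rV[rat]_n :=
  (Num.max (qsqrt K (\sum_(i <- enum 'I_n) z 0 i * z 0 i)) eps)^-1 *: z.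

(** The Riemann sum is recomputed in every step, so that the state of the loop is a single
    vector. *)
Definition pursuer_approx O (j : nat) (p0 q0 : 'rV[rat]_n) (k : nat) : 'rV[rat]_n :=
  iteri k (fun l acc => acc + (2 ^ level O j)%:R^-1 *:
    chase_approx (precision O j) (evader_approx O j q0 l - acc)) p0.

Local Notation definable := (@definable 3).

Lemma def_horizon : definable (fun O _ => horizon O).
Proof.
apply: def_add; last exact: def_const.
apply: def_trunc; apply: defQ_nu; apply: def_nth_decode; last exact: def_const.
by apply: (def_oracle time_oracle); exact: def_const.
Qed.

Lemma def_precision j : definable j -> definable (fun O s => precision O (j O s)).
Proof.
move=> dj; have dH := def_horizon; have c k := def_const 3 k.
apply: def_add dj (def_add (def_mul (c 2) (def_mul (c Ln) dH)) (def_add (c 3)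
  (def_mul (def_mul dH (c Ln)) (def_add (c 4) (def_mul (c 2) dH))))).
Qed.

Lemma def_level j : definable j -> definable (fun O s => level O (j O s)).
Proof.
move=> dj; have dp := def_precision dj.
apply: def_add dp (def_oracle modulus_oracle (def_code_cons def_horizon
  (def_code_cons dp (def_code_nil 3)))).
Qed.

Lemma def_nsteps j : definable j -> definable (fun O s => nsteps O (j O s)).
Proof.
move=> dj; have dl := def_level dj.
apply: def_trunc; apply: defQ_mul; last exact: defQ_nat (def_expn2 dl).
apply: defQ_nu; apply: def_nth_decode; last exact: def_const.
exact: (def_oracle time_oracle dl).
Qed.

Lemma defV_sample j l : definable j -> definable l ->
  definableV (fun O s => sample O (j O s) (l O s)).
Proof.
move=> dj dl; apply: defV_nu; apply: (def_oracle value_oracle).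
apply: def_code_cons; last exact: def_code_cons (def_precision dj) (def_code_nil 3).
apply: def_code_cons dl _; apply: def_code_cons (def_const 3 0) _.
exact: def_code_cons (def_pred (def_expn2 (def_level dj))) (def_code_nil 3).
Qed.

Lemma defQ_step j : definable j -> definableQ (fun O s => (2 ^ level O (j O s))%:R^-1).
Proof.
move=> dj; apply: defQ_inv; first by move=> O s; rewrite ltr0n expn_gt0.
exact: defQ_nat (def_expn2 (def_level dj)).
Qed.

Lemma defV_evader j q k : definable j -> definableV q -> definable k ->
  definableV (fun O s => evader_approx O (j O s) (q O s) (k O s)).
Proof.
move=> dj dq dk; apply: (@defV_iter 3 n (fun O s l acc =>
  acc + (2 ^ level O (j O s))%:R^-1 *: sample O (j O s) l) k q dk dq) => l g dl dg.
have dj2 := def_shift (def_shift dj).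
exact: defV_add (defV_nu n dg) (defV_scale (defQ_step dj2) (defV_sample dj2 dl)).
Qed.

Lemma defV_chase K z : definable K -> definableV z ->
  definableV (fun O s => chase_approx (K O s) (z O s)).
Proof.
move=> dK dz; apply: defV_scale => //; apply: defQ_inv.
  by move=> O s; rewrite lt_max eps_gt0 orbT.
apply: defQ_max; last exact: defQ_const.
apply: defQ_sqrt dK _; apply: defQ_sum => i.
by apply: defQ_mul; exact: defQ_coord.
Qed.

Lemma defV_pursuer j p q k : definable j -> definableV p -> definableV q -> definable k ->
  definableV (fun O s => pursuer_approx O (j O s) (p O s) (q O s) (k O s)).
Proof.
move=> dj dp dq dk; apply: (@defV_iter 3 n (fun O s l acc =>
  acc + (2 ^ level O (j O s))%:R^-1 *: chase_approx (precision O (j O s))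
    (evader_approx O (j O s) (q O s) l - acc)) k p dk dp) => l g dl dg.
have dj2 := def_shift (def_shift dj); have dq2 := defV_shift (defV_shift dq).
apply: defV_add (defV_nu n dg) (defV_scale (defQ_step dj2) (defV_chase
  (def_precision dj2) _)).
apply: defV_ext (defV_add (defV_evader dj2 dq2 dl)
  (defV_scale (defQ_const 3 (-1)) (defV_nu n dg))) => O s.
by rewrite scaleN1r.
Qed.

Lemma pursuer_machine (Mx My : oracle_tm 0) : exists M : oracle_tm 3,
  forall O j cx cy,
    tm_outputs Mx [tuple] (precision O j) cx ->
    tm_outputs My [tuple] (precision O j) cy ->
    exists2 c, tm_outputs M O j c &
      nuQn n c = pursuer_approx O j (nuQn n cx) (nuQn n cy) (nsteps O j).
Proof.
have dj := def_var 3 0.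
have [t1 t1P] := def_precision dj.
have [g [t2 t2P] gP] := defV_pursuer dj (defV_nu n (def_var 3 1))
  (defV_nu n (def_var 3 2)) (def_nsteps dj).
have [M MP] := assembled_machine t1 t2 Mx My; exists M => O j cx cy hx hy.
exists (eval O t2 [:: j; cx; cy]); first by apply: MP; rewrite t1P.
by rewrite t2P gP.
Qed.

End Algorithm.

(** * Error analysis of the rational computation *)

Section Accuracy.
Variables (R : realType) (n : nat).

(** The base 4 is a power of 2, so that the Gronwall factor can be paid for in binary digits;
    [exp (1/2) <= 2] follows from [1 - 1/2 <= exp (- 1/2)]. *)
Lemma expR_nat_le k : expR (k%:R : R) <= 4 ^+ k.
Proof.
have half : expR (2^-1 : R) <= 2.
  have := expR_ge1Dx (- 2^-1 : R); rewrite expRN => H.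
  rewrite -[leRHS]invrK -[leLHS]invrK lef_pV2 ?posrE ?invr_gt0 ?expR_gt0 //.
  by apply: le_trans H; lra.
have e4 : expR (1 : R) <= 4.
  have -> : 1 = 2^-1 + 2^-1 :> R by field.
  rewrite expRD; apply: le_trans (ler_pM (expR_ge0 _) (expR_ge0 _) half half) _.
  by lra.
by rewrite -[k%:R]mul1r expRM_natr lerXn2r ?nnegrE ?expR_ge0.
Qed.

Lemma rpointD (p q : 'rV[rat]_n) : rpoint R (p + q) = rpoint R p + rpoint R q.
Proof. by apply/rowP => i; rewrite !mxE rmorphD. Qed.

Lemma rpointB (p q : 'rV[rat]_n) : rpoint R (p - q) = rpoint R p - rpoint R q.
Proof. by apply/rowP => i; rewrite !mxE rmorphB. Qed.

Lemma rpointZ c (p : 'rV[rat]_n) : rpoint R (c *: p) = ratr c *: rpoint R p.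
Proof. by apply/rowP => i; rewrite !mxE rmorphM. Qed.

Variable eps : rat.
Hypothesis eps_gt0 : 0 < eps.
Let e : R := ratr eps.
Let e_gt0 : 0 < e. Proof. by rewrite ltr0q. Qed.
Local Notation L := (2 / e).
Let L_ge0 : 0 <= L. Proof. by rewrite divr_ge0 // ltW. Qed.

(** The rounded norm [q] falls short of the true one by at most [2 ^- K], and taking the maximum
    with [e] does not widen the gap. *)
Lemma chase_approxP K (z : 'rV[rat]_n) :
  enorm (rpoint R (chase_approx eps K z) - chase e (rpoint R z)) <= L * 2 ^- K.
Proof.
set s := \sum_(i <- enum 'I_n) z 0 i * z 0 i.
have sE : ratr s = enorm (rpoint R z) ^+ 2.
  rewrite sqr_enorm /s big_enum rmorph_sum /=; apply: eq_bigr => i _.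
  by rewrite rmorphM !mxE.
have s0 : 0 <= s.
  by rewrite /s; apply: sumr_ge0 => i _; rewrite -expr2 sqr_ge0.
have [q0 /andP[q1 q2]] := qsqrtP K s0; set q := qsqrt K s in q0 q1 q2.
have r0 : 0 <= ratr q :> R by rewrite ler0q.
have d0 : 0 <= 2 ^- K :> R by rewrite ltW // pow2_gt0.
have r1 : ratr q <= enorm (rpoint R z).
  rewrite -ler_sqr ?nnegrE ?enorm_ge0 // -sE.
  by rewrite -rmorphXn /= ler_rat.
have r2 : enorm (rpoint R z) <= ratr q + 2 ^- K.
  rewrite -ler_sqr ?nnegrE ?enorm_ge0 ?addr_ge0 // -sE.
  have := q2; rewrite -(ltr_rat R) rmorphXn rmorphD /= fmorphV rmorphXn /= ratr_nat.
  exact: ltW.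
rewrite /chase_approx -/s -/q rpointZ fmorphV /=.
have -> : ratr (Num.max q eps) = Num.max (ratr q) e.
  by rewrite !maxElt ltr_rat; case: ifP.
apply: le_trans (scale_inv_dist e_gt0 _ _ _) _ => //; rewrite ?le_max ?lexx ?orbT //.
have H : `|Num.max (ratr q) e - Num.max (enorm (rpoint R z)) e| <= 2 ^- K.
  by apply: le_trans (dist_max _ _ _) _; rewrite ler_norml; lra.
apply: (@le_trans _ _ (e^-1 * 2 ^- K)); first by rewrite ler_wpM2l // invr_ge0 ltW.
by rewrite ler_wpM2r // ler_peMl ?ler1n // invr_ge0 ltW.
Qed.

Variable Ln : nat.
Hypothesis L_le : L <= Ln%:R.
Variables (v x : R -> 'rV[R]_n) (y0 : 'rV[R]_n).
Let y := position y0 v.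
Hypothesis control_v : control v.
Hypothesis pursues_x : pursues e y x.
Variables (t : R) (p a b : nat -> nat) (j : nat).
Hypothesis t_ge0 : 0 <= t.
Hypothesis pP : represents (nuQn 1 \o p) (const_mx t).
Hypothesis abP : represents_fun a b v.

Let O : 3.-tuple (nat -> nat) := [tuple p; a; b].
Variables (N K m M : nat) (h d : R).
Hypothesis NE : horizon O = N.
Hypothesis KE : precision Ln O j = K.
Hypothesis mE : level Ln O j = m.
Hypothesis ME : nsteps Ln O j = M.
Hypothesis hE : h = 2 ^- m.
Hypothesis dE : d = 2 ^- K.

Let h_gt0 : 0 < h. Proof. by rewrite hE pow2_gt0. Qed.
Let h_ge0 : 0 <= h. Proof. exact: ltW. Qed.
Let d_ge0 : 0 <= d. Proof. by rewrite dE ltW // pow2_gt0. Qed.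

Let pow2_anti i k : (i <= k)%N -> 2 ^- k <= 2 ^- i :> R.
Proof.
move=> ik; rewrite lef_pV2 ?posrE ?exprn_gt0 //.
by rewrite ler_weXn2l // ler1n.
Qed.

Let time_approxP k : `|t - ratr (time_approx O k)| <= 2 ^- k.
Proof.
have := coord_le_enorm (const_mx t - rpoint R (nuQn 1 (p k))) 0.
by rewrite !mxE => H; apply: le_trans H (pP k).
Qed.

Let step_le_modulus : h <= 2 ^- b (CodeSeq.code [:: N; K]).
Proof. by rewrite hE; apply: pow2_anti; rewrite -mE /level NE KE leq_addl. Qed.

Let h_le_d : h <= d.
Proof. by rewrite hE dE; apply: pow2_anti; rewrite -mE /level KE leq_addr. Qed.

Let t_le : t + 1 <= N%:R - 1.
Proof.
have := time_approxP 0; rewrite expr0 invr1 ler_norml => /andP[_ H].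
have := truncnS_gt (time_approx O 0); rewrite -(ltr_rat R) ratr_nat.
by rewrite -NE /horizon natrD -[X in _ < X]natr1; lra.
Qed.

(** One [h] is for the approximation of the time, one for the truncation to the grid. If the
    approximation is negative, then [M = 0] and [t] is below [h]. *)
Let last_step : M%:R * h <= N%:R /\ `|t - M%:R * h| <= 2 * h.
Proof.
have h1 : h <= 1 by rewrite hE pow2_le1.
have := time_approxP m; rewrite -hE ler_norml => /andP[t1 t2].
have p2 : 0 < (2 ^ m)%:R :> R by rewrite ltr0n expn_gt0.
have hE' : h = (2 ^ m)%:R^-1 by rewrite hE natrX.
move: ME; rewrite /nsteps mE; set u := time_approx O m in t1 t2 * => ME'.
have [u0|u0] := leP 0 u.
  have /truncn_itv : 0 <= u * (2 ^ m)%:R by rewrite mulr_ge0.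
  rewrite ME' => /andP[].
  rewrite -(ler_rat R) -(ltr_rat R) rmorphM /= !ratr_nat => k1 k2.
  have {}k1 : M%:R * h <= ratr u by rewrite hE' ler_pdivrMr.
  have {}k2 : ratr u < M%:R * h + h.
    by rewrite -[X in _ + X]mul1r -mulrDl natr1 hE' ltr_pdivlMr.
  by split; [have := t_le; lra|rewrite ler_norml; lra].
have M0 : M = 0%N.
  by rewrite -ME' truncn_floor leNgt nmulr_rlt0 ?ltr0n ?expn_gt0.
have : ratr u < 0 :> R by rewrite ltrq0.
rewrite M0 mul0r subr0 ger0_norm // => u0'; split; first exact: ler0n.
by lra.
Qed.

Let in_horizon k : (k <= M)%N -> 0 <= k%:R * h <= N%:R.
Proof.
move=> kM; rewrite mulr_ge0 //=; apply: le_trans last_step.1.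
by rewrite ler_wpM2r // ler_nat.
Qed.

Let ratr_step : ratr (2 ^ m)%:R^-1 = h :> R.
Proof. by rewrite fmorphV /= ratr_nat natrX hE. Qed.

(** Each step adds [h * d] for the inexact value of [v] and [h * d] for the variation of [v] within
    the step. *)
Let evader_error (q0 : 'rV[rat]_n) k : enorm (y0 - rpoint R q0) <= d -> (k <= M)%N ->
  enorm (rpoint R (evader_approx Ln O j q0 k) - y (k%:R * h)) <= d + k%:R * h * (2 * d).
Proof.
move=> q0P; elim: k => [|k IH] kM.
  by rewrite !mul0r addr0 /y position0 enormC.
have {}IH := IH (ltnW kM); rewrite /evader_approx /= -/(evader_approx _ _ _ _ _) mE.
rewrite rpointD rpointZ ratr_step.
set E := rpoint R (evader_approx _ _ _ _ _) in IH *.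
set V := rpoint R (sample _ _ _ _ _).
have kS : k.+1%:R * h = k%:R * h + h by rewrite -natr1 mulrDl mul1r.
have /andP[k0 _] := in_horizon (ltnW kM); have /andP[_ kN] := in_horizon kM.
have VP : enorm (v (k%:R * h) - V) <= d.
  have [va _] := abP; have := va (CodeSeq.code [:: k; 0; (2 ^ m).-1]%N) K.
  rewrite -dE.
  have -> : nuQ (CodeSeq.code [:: k; 0; (2 ^ m).-1]%N) = k%:R * (2 ^ m)%:R^-1.
    by rewrite /nuQ CodeSeq.codeK /= subr0 prednK ?expn_gt0.
  rewrite rmorphM /= ratr_nat ratr_step /V /sample mE KE; apply.
  by rewrite mulr_ge0.
have yP : enorm (y (k.+1%:R * h) - y (k%:R * h) - h *: v (k%:R * h)) <= d * h.
  have := @position_dist R n v y0 (v (k%:R * h)) d (k%:R * h) (k.+1%:R * h) control_v.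
  rewrite k0 kS lerDl h_ge0 => /(_ isT).
  have -> : k%:R * h + h - k%:R * h = h by rewrite addrAC subrr add0r.
  apply=> r /andP[r1 r2]; have [_ vb] := abP; rewrite dE; apply: (vb N K).
  - by rewrite (le_trans k0 r1) /=; move: kN; rewrite kS; lra.
  - by rewrite k0 /=; move: kN; rewrite kS; lra.
  - apply: le_trans step_le_modulus; rewrite ler_norml; lra.
have -> : E + h *: V - y (k.+1%:R * h) = (E - y (k%:R * h))
   - h *: (v (k%:R * h) - V) - (y (k.+1%:R * h) - y (k%:R * h) - h *: v (k%:R * h)).
  move: (y _) (y _) (v _) => A B C.
  by apply/rowP => i; rewrite !mxE; ring.
apply: le_trans (enormB _ _) _; apply: le_trans (lerD (enormB _ _) yP) _.
rewrite enormZ ger0_norm // kS.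
by have := ler_wpM2l h_ge0 VP; lra.
Qed.

Lemma pursuer_error (p0 q0 : 'rV[rat]_n) :
  enorm (x 0 - rpoint R p0) <= d -> enorm (y0 - rpoint R q0) <= d ->
  enorm (rpoint R (pursuer_approx eps Ln O j p0 q0 M) - x t) <= 2 ^- j.
Proof.
move=> p0P q0P; pose xi k := rpoint R (pursuer_approx eps Ln O j p0 q0 k).
pose G k z := chase e (y (k%:R * h) - z).
have [slow_x px] := pursues_x.
(* [d1] collects the rounding of [chase], at most [L * d], and the effect [L * (d + N * (2 * d))] of
   the error in Evader's position; [d2] comes from the defect [2 * L * h ^ 2] of the exact
   trajectory and [h <= d]. *)
pose d1 := L * (2 + 2 * N%:R) * d; pose d2 := L * 2 * d.
have N0 : 0 <= N%:R :> R by [].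
have d10 : 0 <= d1 by rewrite mulr_ge0 // (mulr_ge0 L_ge0) // addr_ge0 // mulr_ge0.
have d20 : 0 <= d2 by rewrite mulr_ge0 // (mulr_ge0 L_ge0).
have xiP k : (k < M)%N -> enorm (xi k.+1 - xi k - h *: G k (xi k)) <= h * d1.
  move=> kM; rewrite /xi /pursuer_approx /= -/(pursuer_approx _ _ _ _ _ _ _) mE.
  rewrite rpointD rpointZ ratr_step KE.
  set E := evader_approx _ _ _ _ _; set X := pursuer_approx _ _ _ _ _ _ _.
  have -> : rpoint R X + h *: rpoint R (chase_approx eps K (E - X)) - rpoint R X
      - h *: G k (rpoint R X) = h *: (rpoint R (chase_approx eps K (E - X)) - G k (rpoint R X)).
    rewrite scalerBr; move: (h *: rpoint R _) (h *: G _ _) => A B.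
    by rewrite [_ + A]addrC addrK.
  rewrite enormZ ger0_norm // ler_wpM2l //.
  apply: le_trans (enorm_dist (chase e (rpoint R (E - X))) _ _) _.
  apply: le_trans (lerD (chase_approxP _ _) (chase_lip e_gt0 _ _)) _.
  rewrite rpointB opprB addrA subrK -dE.
  have H : enorm (rpoint R E - y (k%:R * h)) <= d + N%:R * (2 * d).
    apply: le_trans (evader_error q0P (ltnW kM)) _; rewrite lerD2l ler_wpM2r //.
      by rewrite mulr_ge0.
    by have /andP[] := in_horizon (ltnW kM).
  by have := ler_wpM2l L_ge0 H; rewrite /d1; lra.
have etaP k : (k < M)%N ->
    enorm (x (k.+1%:R * h) - x (k%:R * h) - h *: G k (x (k%:R * h))) <= h * d2.
  move=> kM; have -> : k.+1%:R * h = k%:R * h + h by rewrite -natr1 mulrDl mul1r.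
  apply: le_trans (px _ _ _ _) _ => //; first by rewrite mulr_ge0.
  rewrite expr2 /d2; have := ler_wpM2l (mulr_ge0 L_ge0 h_ge0) h_le_d; lra.
have := gronwall L_ge0 h_ge0 d10 d20 (fun k => chase_sub_lip e_gt0 (y (k%:R * h)))
  xiP etaP (leqnn M).
rewrite mul0r -/(xi M) => gr.
have [MN tM] := last_step.
have xt : enorm (x (M%:R * h) - x t) <= 2 * d.
  apply: (@le_trans _ _ `|t - M%:R * h|); last by have := h_le_d; lra.
  have M0 : 0 <= M%:R * h by rewrite mulr_ge0.
  have [st|ts] := leP (M%:R * h) t.
    by rewrite enormC ger0_norm ?subr_ge0 //; apply: slow_x; rewrite M0.
  by rewrite ltr0_norm ?subr_lt0 // opprB; apply: slow_x; rewrite t_ge0 ltW.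
apply: le_trans (enorm_dist (x (M%:R * h)) _ _) _.
apply: le_trans (lerD gr xt) _.
pose Q : R := (4 ^ (Ln * N))%:R.
have Q1 : 1 <= Q by rewrite ler1n expn_gt0.
have growth : (1 + L * h) ^+ M <= Q.
  apply: le_trans (pow_1D_le_expR _ (mulr_ge0 L_ge0 h_ge0)) _.
  apply: le_trans (_ : expR ((Ln * N)%:R : R) <= _).
    rewrite ler_expR mulrCA natrM ler_pM //.
    by rewrite mulr_ge0.
  by rewrite /Q natrX; exact: expR_nat_le.
(* In units of [d]: 1 for the starting point, 2 for the stretch between the last grid time and [t],
   and the rest for the accumulated defects [N * (d1 + d2)] with [L] replaced by [Ln]. *)
pose c := (3 + N * Ln * (4 + 2 * N))%N.
have dQc : d * (Q * (2 ^ c)%:R) = 2 ^- j.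
  have -> : Q = 2 ^+ (2 * (Ln * N)) by rewrite /Q -[4%N]/(2 ^ 2)%N -expnM natrX.
  by rewrite natrX -exprD dE -KE /precision NE -/c exprD invfM -mulrA mulVf ?mulr1.
have cc : (c%:R : R) <= (2 ^ c)%:R by rewrite ler_nat ltnW // ltn_expl.
rewrite -dQc.
have start : enorm (rpoint R p0 - x 0) <= d by rewrite enormC.
have tail : M%:R * h * (d1 + d2) <= N%:R * (Ln%:R * (4 + 2 * N%:R) * d).
  apply: ler_pM => //; [by rewrite mulr_ge0|exact: addr_ge0|].
  rewrite /d1 /d2 -mulrDl ler_wpM2r //.
  have -> : L * (2 + 2 * N%:R) + L * 2 = L * (4 + 2 * N%:R) by ring.
  by rewrite ler_wpM2r // addr_ge0 // mulr_ge0.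
have body := lerD start tail; have A0 : 0 <= (1 + L * h) ^+ M.
  by rewrite exprn_ge0 // addr_ge0 // mulr_ge0.
have B0 : 0 <= enorm (rpoint R p0 - x 0) + M%:R * h * (d1 + d2).
  rewrite addr_ge0 ?enorm_ge0 // mulr_ge0 ?addr_ge0 //.
  by rewrite mulr_ge0.
have := ler_pM A0 B0 growth body.
have cE : c%:R = 3 + N%:R * Ln%:R * (4 + 2 * N%:R) :> R by rewrite /c natrD !natrM natrD natrM.
have dQ : 2 * d <= 2 * d * Q by rewrite ler_peMr // mulr_ge0.
have : d * (Q * c%:R) <= d * (Q * (2 ^ c)%:R).
  by rewrite ler_wpM2l // ler_wpM2l // (le_trans ler01).
rewrite cE; lra.
Qed.

End Accuracy.

(** * The strategy wins and its trajectories are computable *)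

Lemma compact_enorm_bounded (R : realType) (n : nat) (S : set 'rV[R]_n) :
  compact S -> exists D, forall z, S z -> enorm z <= D.
Proof.
move=> /compact_bounded[M [_ MP]]; exists (\sum_(i < n) (M + 1)) => z Sz.
apply: le_trans (enorm_le_sum z) _; apply: ler_sum => i _.
apply: le_trans (MP (M + 1) _ z Sz); last by rewrite ltrDl.
rewrite [leRHS]/Num.norm /= mx_normrE; apply/bigmax_geP; right => /=.
by exists (0, i).
Qed.

Theorem theorem13 (R : realType) (n : nat) (S : set 'rV[R]_n) (eps : rat)
    (x0 y0 : 'rV[R]_n)
    (S_compact : compact S) (S_computable : computable_convex_set S)
    (eps_gt0 : 0 < eps)
    (Sx0 : S x0) (Sy0 : S y0)
    (x0_computable : computable_point x0) (y0_computable : computable_point y0)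
    (x0y0_far : ratr eps < enorm (x0 - y0)) :
  exists u : strategy R n,
    winning S (ratr eps) x0 y0 u /\
    forall v : R -> 'rV[R]_n,
      evasion S y0 v -> {within `[0, +oo[, continuous v} ->
      forall x : R -> 'rV[R]_n, trajectory x0 y0 u v x ->
        computable_relative v x.
Proof.
have e_gt0 : 0 < ratr eps :> R by rewrite ltr0q.
exists (chaser (ratr eps)); split.
  move=> v [cv Sy].
  have [x [px x00 Sx]] := pursuit_exists e_gt0 x0 (slow_position y0 cv).
  have [_ clS cvS _ _] := S_computable.
  have {}Sx := Sx S clS cvS Sx0 Sy.
  exists x; split=> //.
  - exact: pursues_trajectory.
  - move=> x' /(trajectory_pursues e_gt0 cv)[px' x'00] t t0.
    by apply: (pursues_unique e_gt0 px' px); rewrite ?x00.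
  - have [D DP] := compact_enorm_bounded S_compact.
    apply: (capture e_gt0 (slow_position y0 cv) px (D := D)) => t t0.
    by split; apply: DP; [exact: Sx|exact: Sy].
move=> v [cv Sy] _ x /(trajectory_pursues e_gt0 cv)[px x00].
have [phi [Mx MxP] phiP] := x0_computable.
have [psi [My MyP] psiP] := y0_computable.
pose Ln := (Num.truncn (2 / ratr eps : R)).+1.
have LnP : 2 / ratr eps <= Ln%:R :> R by rewrite ltW // truncnS_gt.
(* Only [n], [eps], [Ln] and the machines of the starting points are built in; the time and [v]
   enter through the oracles, so one machine serves them all. *)
have [M MP] := pursuer_machine n Ln eps_gt0 Mx My.
exists M => t p a b t0 pP abP j.
set O := [tuple p; a; b] in MP *.
have [cx hx cxE] := MxP (precision Ln O j).
have [cy hy cyE] := MyP (precision Ln O j).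
have [c hc cE] := MP O j cx cy hx hy; exists c => //.
rewrite cE cxE cyE.
apply: (pursuer_error eps_gt0 LnP cv px t0 pP abP erefl erefl erefl erefl erefl erefl).
- by rewrite x00; exact: phiP.
- exact: psiP.
Qed.
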